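(* Let $V\subset\mathbb{A}^n$ be an irreducible $\Delta$-variety over $\mathcal{F}$ of Kolchin polynomial $$\omega_V(t)=(d+1)\binom{t+m}{m}-\binom{t+m-s}{m},$$ and let $F(\mathbf{u}_0,\ldots,\mathbf{u}_d)$ be the $\Delta$-Chow form of $V$. Then $F(\mathbf{u}_0,\ldots,\mathbf{u}_d)$ is $\Delta$-homogeneous of the same degree $r$ in each $\mathbf{u}_i$ ($i=0,\ldots,d$).
   Context: Setting: $m\ge 2$; $\mathcal{F}$ is a field of characteristic $0$ with commuting derivations $\Delta=\{\delta_1,\ldots,\delta_m\}$, and $\mathcal{E}$ is a universal $\Delta$-extension field of $\mathcal{F}$; $d,s\in\mathbb{N}$. $\Theta$ is the free commutative monoid generated by $\Delta$, $\mathrm{ord}(\prod\delta_i^{e_i})=\sum e_i$. $\mathcal{F}\{\mathbb{Y}\}$ is the $\Delta$-polynomial ring in $\mathbb{Y}=\{y_1,\ldots,y_n\}$; $[S]$ denotes the generated $\Delta$-ideal. A $\Delta$-variety over $\mathcal{F}$ is the zero set in $\mathbb{A}^n=\mathcal{E}^n$ of a subset of $\mathcal{F}\{\mathbb{Y}\}$; it is irreducible iff its vanishing $\Delta$-ideal $\mathbb{I}(V)\subseteq\mathcal{F}\{\mathbb{Y}\}$ is prime. $\omega_V(t)$ is the numerical polynomial equal for all large $t$ to the dimension of $\mathbb{I}(V)\cap\mathcal{F}[\theta(y_j):\mathrm{ord}(\theta)\le t,\,1\le j\le n]$. $\Delta$-Chow form: for $V$ as in the claim ($V$ then has $\Delta$-dimension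 $d$), let $\mathbb{L}_i=u_{i0}+u_{i1}y_1+\cdots+u_{in}y_n$ ($i=0,\ldots,d$) with all $u_{ij}$ independent $\Delta$-indeterminates, $\mathbf{u}_i=(u_{i0},\ldots,u_{in})$. The $\Delta$-Chow form of $V$ is the irreducible $\Delta$-polynomial $F\in\mathcal{F}\{\mathbf{u}_0,\ldots,\mathbf{u}_d\}$ (which exists for such $V$ and is unique up to a nonzero factor in $\mathcal{F}$) with $$[\mathbb{I}(V),\mathbb{L}_0,\ldots,\mathbb{L}_d]_{\mathcal{F}\{\mathbb{Y},\mathbf{u}_0,\ldots,\mathbf{u}_d\}}\cap\mathcal{F}\{\mathbf{u}_0,\ldots,\mathbf{u}_d\}=\mathrm{sat}(F),$$ where $\mathrm{sat}(F)=[F]:(I_FS_F)^\infty$ with $I_F$, $S_F$ the initial and separant of $F$ under any ranking (leader = highest derivative appearing in $F$; initial = coefficient of the highest power of the leader; separant = partial derivative of $F$ with respect to its leader). $F$ is $\Delta$-homogeneous of degree $r$ in $\mathbf{u}_i$ if, for a $\Delta$-indeterminate $\lambda$ over $\mathcal{F}\{\mathbf{u}_0,\ldots,\mathbf{u}_d\}$, replacing $\mathbf{u}_i$ by $\lambda\mathbf{u}_i=(\lambda u_{i0},\ldots,\lambda u_{in})$ in $F$ (other $\mathbf{u}_k$ unchanged) gives $\lambda^rF$. *)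

(* Defs.v *)
From HB Require Import structures.
From mathcomp Require Import all_boot all_order all_algebra.
From mathcomp Require Import finmap.
From mathcomp Require Import monalg.

Set Implicit Arguments.
Unset Strict Implicit.
Unset Printing Implicit Defensive.

Import GRing.Theory.

Local Open Scope ring_scope.

Section CommutativeAlgebra.
Variable A : comNzRingType.
Implicit Types (B I P : A -> Prop) (a b x y : A).

(* Ideals of the subring of A whose membership predicate is B. *)
Definition ideal_in B I : Prop :=
  [/\ forall x, I x -> B x,
      I 0,
      forall x y, I x -> I y -> I (x + y)
    & forall a x, B a -> I x -> I (a * x)].

Definition prime_ideal_in B P : Prop :=
  [/\ ideal_in B P, ~ P 1
    & forall a b, B a -> B b -> P (a * b) -> P a \/ P b].

Definition whole_ring : A -> Prop := fun=> True.
Definition ideal := ideal_in whole_ring.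
Definition prime_ideal := prime_ideal_in whole_ring.

(* C 0 < C 1 < ... < C k, all prime in B and all containing I. *)
Definition prime_chain B I (C : nat -> A -> Prop) (k : nat) : Prop :=
  [/\ forall i, (i <= k)%N -> prime_ideal_in B (C i),
      forall x, I x -> C 0%N x
    & forall i, (i < k)%N ->
        (forall x, C i x -> C i.+1 x) /\ (exists x, C i.+1 x /\ ~ C i x)].

(* The Krull dimension of the quotient of the subring B by I is k. *)
Definition ideal_dim B I (k : nat) : Prop :=
  (exists C, prime_chain B I C k) /\
  (forall C k', prime_chain B I C k' -> (k' <= k)%N).

Definition invertible a : Prop := exists b, a * b = 1.

Definition irreducible a : Prop :=
  [/\ a <> 0, ~ invertible a
    & forall b c, a = b * c -> invertible b \/ invertible c].

End CommutativeAlgebra.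

Section DeltaField.
Variable m : nat.

Record deltaField := DeltaField {
  df_field :> fieldType;
  df_der : 'I_m -> df_field -> df_field;
  df_char0 : [pchar df_field] =i pred0;
  df_derD : forall i x y, df_der i (x + y) = df_der i x + df_der i y;
  df_derM : forall i x y, df_der i (x * y) = df_der i x * y + x * df_der i y;
  df_derC : forall i j x, df_der i (df_der j x) = df_der j (df_der i x)
}.

(* Field morphisms are injective, so a delta-extension K <= L is given by a
   ring morphism K -> L commuting with the derivations. *)
Definition delta_morphism (K L : deltaField) (f : K -> L) : Prop :=
  forall i x, f (df_der i x) = df_der i (f x).

(* L is generated, as a delta-field extension of K, by a finite set. *)
Definition delta_fin_gen (K L : deltaField) (f : K -> L) : Prop :=
  exists s : seq L, forall S : L -> Prop,
    (forall a, S (f a)) -> (forall a, a \in s -> S a) ->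
    (forall x y, S x -> S y -> S (x - y)) ->
    (forall x y, S x -> S y -> S (x * y)) ->
    (forall x, S x -> S x^-1) ->
    (forall i x, S x -> S (df_der i x)) ->
    forall x, S x.

(* Universal extensions in the sense of Kolchin: for every finitely generated
   delta-extension K of F inside E, every finitely generated delta-extension L
   of K embeds into E over K. *)
Definition universal_ext (F E : deltaField) (iota : {rmorphism F -> E}) : Prop :=
  delta_morphism iota /\
  forall (K : deltaField) (f : {rmorphism F -> K}) (j : {rmorphism K -> E}),
    delta_morphism f -> delta_morphism j -> delta_fin_gen f ->
    (forall x, j (f x) = iota x) ->
    forall (L : deltaField) (g : {rmorphism K -> L}),
      delta_morphism g -> delta_fin_gen g ->
      exists h : {rmorphism L -> E},
        delta_morphism h /\ forall x, h (g x) = j x.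

End DeltaField.

(* prod_i delta_i ^ (e i) is represented by its vector e of exponents, so the
   law of the monoid Theta is the addition of vectors. *)
Definition Theta (m : nat) : nmodType := {ffun 'I_m -> nat}.

Definition theta_delta (m : nat) (i : 'I_m) : Theta m :=
  [ffun j => nat_of_bool (j == i)].

Definition theta_ord (m : nat) (e : {ffun 'I_m -> nat}) : nat :=
  (\sum_(i < m) e i)%N.

(* (j, theta) stands for the derivative theta(y_j). *)
Definition dvar (m : nat) (J : choiceType) : choiceType := (J * Theta m)%type.

Definition dpoly (m : nat) (K : deltaField m) (J : choiceType) :=
  {malg K[{cmonom (dvar m J)}]}.

(* The monomial c * mu and the product are those of monalg. They are locked
   because unfolding them makes failing conversion tests intractable. *)
HB.lock Definition dp_mono (m : nat) (K : deltaField m) (J : choiceType)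
    (c : K) (mu : {cmonom (dvar m J)}) : dpoly K J := << c *g mu >>.

HB.lock Definition dp_mul (m : nat) (K : deltaField m) (J : choiceType)
    (p q : dpoly K J) : dpoly K J :=
  (p : {malg K[{cmonom (dvar m J)}]}) * q.

Section RingStructure.
Variables (m : nat) (K : deltaField m) (J : choiceType).

HB.instance Definition _ := GRing.Zmodule.on (dpoly K J).

Let one : dpoly K J := 1 : {malg K[{cmonom (dvar m J)}]}.

Fact dp_mulA : associative (@dp_mul m K J).
Proof. by move=> p q r; rewrite dp_mul.unlock; apply: mulrA. Qed.

Fact dp_mulC : commutative (@dp_mul m K J).
Proof. by move=> p q; rewrite dp_mul.unlock; apply: mulrC. Qed.

Fact dp_mul1 : left_id one (@dp_mul m K J).
Proof. by move=> p; rewrite dp_mul.unlock; apply: mul1r. Qed.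

Fact dp_mulDl : left_distributive (@dp_mul m K J) +%R.
Proof. by move=> p q r; rewrite dp_mul.unlock; apply: mulrDl. Qed.

Fact dp_oner_neq0 : one != 0.
Proof. exact: oner_neq0. Qed.

HB.instance Definition _ := GRing.Zmodule_isComNzRing.Build (dpoly K J)
  dp_mulA dp_mulC dp_mul1 dp_mulDl dp_oner_neq0.

End RingStructure.

Section DeltaPolynomials.
Variable m : nat.

Section Operations.
Variables (K : deltaField m) (J : choiceType).
Implicit Types (p : dpoly K J) (v w : dvar m J) (j : J).

Definition dC (c : K) : dpoly K J := dp_mono c mone.

Definition dX v : dpoly K J := dp_mono 1 (ucm v).

Definition dY j : dpoly K J := dX (j, 0).

Definition dvars p : {fset (dvar m J)} := (\bigcup_(mu <- msupp p) finsupp mu)%fset.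

Definition partial v p : dpoly K J :=
  \sum_(mu <- msupp p) dp_mono (p@_mu *+ mu v) (divcm mu (ucm v)).

(* The derivation extending that of K and mapping theta(y_j) to
   (delta_i theta)(y_j). *)
Definition dp_der (i : 'I_m) p : dpoly K J :=
  \sum_(mu <- msupp p) dp_mono (df_der i p@_mu) mu
  + \sum_(v <- dvars p) partial v p * dX (v.1, v.2 + theta_delta i).

Definition deg_in v p : nat := \max_(mu <- msupp p) mu v.

(* The coefficient of v ^+ deg_in v p in p, and dp/dv. *)
Definition initial v p : dpoly K J :=
  \sum_(mu <- msupp p | mu v == deg_in v p)
     dp_mono p@_mu (divcm mu (expcmn (ucm v) (deg_in v p))).

Definition separant v p : dpoly K J := partial v p.

Definition ord_le (t : nat) p : Prop :=
  forall v, v \in dvars p -> (theta_ord v.2 <= t)%N.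

Definition delta_ideal (I : dpoly K J -> Prop) : Prop :=
  ideal I /\ forall i p, I p -> I (dp_der i p).

Definition delta_gen (S : dpoly K J -> Prop) : dpoly K J -> Prop :=
  fun p => forall I, delta_ideal I -> (forall q, S q -> I q) -> I p.

End Operations.

(* rk w v reads: w is lower than or equal to v. *)
Definition ranking (J : choiceType) (rk : rel (dvar m J)) : Prop :=
  [/\ total rk, antisymmetric rk, transitive rk,
      forall (j : J) (e f : Theta m), rk (j, e) (j, f + e)
    & forall (j k : J) (e e' f : Theta m),
        rk (j, e) (k, e') -> rk (j, f + e) (k, f + e')].

Definition leader (K : deltaField m) (J : choiceType) (rk : rel (dvar m J))
    (v : dvar m J) (p : dpoly K J) : Prop :=
  v \in dvars p /\ forall w, w \in dvars p -> rk w v.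

Definition sat (K : deltaField m) (J : choiceType) (rk : rel (dvar m J))
    (p : dpoly K J) : dpoly K J -> Prop :=
  fun q => exists2 v, leader rk v p &
    exists k : nat,
      delta_gen (fun f => f = p) ((initial v p * separant v p) ^+ k * q).

Section Evaluation.
Variables (K : deltaField m) (J : choiceType) (A : comNzRingType).

(* The operator prod_i delta_i ^ (e i); the order of composition is irrelevant
   since the derivations D are meant to commute. *)
Definition theta_app (D : 'I_m -> A -> A) (e : Theta m) (a : A) : A :=
  foldr (fun i => iter (e i) (D i)) a (enum 'I_m).

(* The value of p after replacing each coefficient c by f c and each
   theta(y_j) by theta(x j), where (A, D) is a differential ring. *)
Definition dp_eval (D : 'I_m -> A -> A) (f : K -> A) (x : J -> A)
    (p : dpoly K J) : A :=
  mmap f (fun mu : {cmonom (dvar m J)} =>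
            \prod_(v <- finsupp mu) theta_app D v.2 (x v.1) ^+ mu v) p.

End Evaluation.

Definition dp_subst (K : deltaField m) (J J' : choiceType)
    (x : J -> dpoly K J') (p : dpoly K J) : dpoly K J' :=
  dp_eval (@dp_der K J') (@dC K J') x p.

Definition dp_rename (K : deltaField m) (J J' : choiceType) (r : J -> J')
    (p : dpoly K J) : dpoly K J' :=
  dp_subst (fun j => dY K (r j)) p.

End DeltaPolynomials.

Section Varieties.
Variables (m n : nat) (F E : deltaField m) (iota : {rmorphism F -> E}).

Definition eval_at (a : 'rV[E]_n) (p : dpoly F 'I_n) : E :=
  dp_eval (@df_der m E) iota (a 0) p.

Definition delta_variety (V : 'rV[E]_n -> Prop) : Prop :=
  exists S : dpoly F 'I_n -> Prop,
    forall a, V a <-> forall p, S p -> eval_at a p = 0.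

Definition vanishing_ideal (V : 'rV[E]_n -> Prop) : dpoly F 'I_n -> Prop :=
  fun p => forall a, V a -> eval_at a p = 0.

Definition irreducible_variety (V : 'rV[E]_n -> Prop) : Prop :=
  delta_variety V /\ prime_ideal (vanishing_ideal V).

(* ord_le t is the polynomial ring in the theta(y_j) with ord theta <= t. *)
Definition is_kolchin_poly (V : 'rV[E]_n -> Prop) (w : {poly rat}) : Prop :=
  exists t0 : nat, forall t : nat, (t0 <= t)%N ->
    exists2 k : nat,
      ideal_dim (@ord_le m F 'I_n t)
        (fun p => vanishing_ideal V p /\ ord_le t p) k
      & w.[t%:R] = k%:R.

End Varieties.

(* The binomial coefficient p choose k, as a polynomial. *)
Definition bin_poly (p : {poly rat}) (k : nat) : {poly rat} :=
  (k`!%:R)^-1 *: \prod_(i < k) (p - i%:R%:P).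

Section ChowForm.
Variables (m n d : nat) (F : deltaField m).

(* (i, j) stands for u_ij. *)
Definition uvar : choiceType := ('I_d.+1 * 'I_n.+1)%type.

(* The indeterminates of F{Y, u_0, ..., u_d}: inl j is y_(j+1). *)
Definition yuvar : choiceType := ('I_n + uvar)%type.

Definition generic_hyperplane (i : 'I_d.+1) : dpoly F yuvar :=
  dY F (inr (i, ord0) : yuvar)
  + \sum_(j < n) dY F (inr (i, lift ord0 j) : yuvar) * dY F (inl j : yuvar).

Definition chow_ideal (I : dpoly F 'I_n -> Prop) : dpoly F uvar -> Prop :=
  fun g =>
    delta_gen
      (fun f : dpoly F yuvar =>
         (exists2 p, I p & f = dp_rename (inl : _ -> yuvar) p) \/
         (exists i, f = generic_hyperplane i))
      (dp_rename (inr : _ -> yuvar) g).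

Definition is_chow_form (rk : rel (dvar m uvar)) (I : dpoly F 'I_n -> Prop)
    (f : dpoly F uvar) : Prop :=
  irreducible f /\ forall g, chow_ideal I g <-> sat rk f g.

(* None stands for lambda. *)
Definition scale_block (i : 'I_d.+1) (u : uvar) : dpoly F (option uvar) :=
  if u.1 == i then dY F None * dY F (Some u) else dY F (Some u).

Definition delta_homogeneous (i : 'I_d.+1) (r : nat) (f : dpoly F uvar) : Prop :=
  dp_subst (scale_block i) f = dY F None ^+ r * dp_rename Some f.

End ChowForm.

(* Main.v *)
From HB Require Import structures.
Require Import Defs.
From mathcomp Require Import all_boot all_order all_algebra.
From mathcomp Require Import perm.
From mathcomp Require Import finmap monalg ring.
From Stdlib Require Import Classical.

Set Implicit Arguments.
Unset Strict Implicit.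
Unset Printing Implicit Defensive.

Import GRing.Theory.

Local Open Scope ring_scope.

(** Write P for the ideal of the u-variables whose members lie in the ideal
generated by I and the generic hyperplanes L_0, ..., L_d; the Chow form f is
irreducible and P = sat(f). Two operations stabilize P. A permutation of the
blocks u_i permutes the L_i, hence maps P into itself. Replacing u_i by
lambda u_i multiplies L_i by lambda, so it maps P into the ideal that P
generates after adjunction of lambda; thus, in the expansion of g(lambda u_i)
along the monomials nu in the derivatives of lambda, every coefficient of a
member g of P lies in P ([chow_ideal_move], [chow_ideal_lcoef]). Applied to f,
both operations yield members of P of total degree at most deg f.

The heart of the proof turns such members into constant multiples of f:
a member of sat(f) none of whose variables exceeds the leader of f is divisible
by f ([sat_low_divides]). It rests on two facts. First, if h is in [f] and no
variable of h exceeds the leader v of f, then f divides S^N h for some N, with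
S the separant ([rosenfeld]): each proper derivative theta f equals
S theta v plus terms in lower variables, so theta v can be eliminated from
an expression of h, starting with the highest one. Second, f is prime, by
unique factorization in polynomial rings ([dp_irreducible_prime]); it divides
neither its initials nor its separants, whose degrees are too small. The leader
used here may be taken for any ranking, not only the one that defines sat(f).

This freedom gives the symmetry. Let s exchange two blocks. If the leader of
s(f) does not exceed that of f, then s(f) is low for the given ranking rk;
otherwise it is low for the ranking rk transported by s. Hence s(f) = a f with
a constant a ([chow_form_move]).

For the homogeneity, the coefficient of nu in f(lambda u_i) only involves lower
derivatives of variables of f, so it equals c_nu f for a constant c_nu.
By the Leibniz rule theta(lambda y) is lambda theta(y) plus terms where y is
derived fewer times. At a monomial mu of f of maximal total order these terms
do not contribute: there, f(lambda u_i) has the same coefficient as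
lambda^r f, with r the degree of mu in u_i. Therefore c_nu is 1 for
nu = lambda^r and 0 otherwise, that is f(lambda u_i) = lambda^r f
([chow_form_homogeneous_block]). Conjugating this identity by the exchange of
u_0 and u_i shows that r does not depend on i. *)

(** * Factoriality of polynomial rings *)

Definition divides (A : comNzRingType) (a b : A) := exists q, b = a * q.

Definition prime_elt (R : idomainType) (p : R) :=
  [/\ p != 0, p \isn't a GRing.unit
    & forall a b, divides p (a * b) -> divides p a \/ divides p b].

Definition all_prime (R : idomainType) (s : seq R) :=
  forall p, p \in s -> prime_elt p.

(** Unique factorization is stated as the existence of factorizations into prime
elements, from which uniqueness follows. *)
Definition factorial_ring (R : idomainType) :=
  forall a : R, a != 0 ->
    exists u s, [/\ u \is a GRing.unit, all_prime s & a = u * \prod_(p <- s) p].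

Section Factorial.
Variable R : idomainType.
Implicit Types (a b c p q u : R) (s : seq R) (f g h : {poly R}).

Lemma all_prime_cons p s : all_prime (p :: s) <-> prime_elt p /\ all_prime s.
Proof.
split=> [sP|[pP sP] q].
  by split=> [|q qs]; apply: sP; rewrite inE ?eqxx // qs orbT.
by rewrite inE => /predU1P[->|/sP].
Qed.

Lemma all_prime_cat s t : all_prime s -> all_prime t -> all_prime (s ++ t).
Proof. by move=> sP tP p; rewrite mem_cat => /orP[/sP|/tP]. Qed.

Lemma prime_assoc p q : prime_elt p -> prime_elt q -> divides p q ->
  exists2 w, w \is a GRing.unit & q = p * w.
Proof.
move=> [p0 pU _] [q0 _ qP] [w qE]; exists w => //.
have /qP[[t tE]|[t tE]] : divides q (p * w) by exists 1; rewrite -qE mulr1.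
  apply/unitrP; exists t; suff wt : w * t = 1 by rewrite mulrC.
  by apply: (mulfI p0); rewrite mulrA -qE -tE mulr1.
case/negP: pU; apply/unitrP; exists t.
have w0 : w != 0 by apply: contraNneq q0 => w0; rewrite qE w0 mulr0.
suff pt : p * t = 1 by rewrite mulrC.
by apply: (mulfI w0); rewrite mulr1 mulrCA mulrA -qE -tE.
Qed.

Lemma prime_dvd_prod p s : prime_elt p -> all_prime s ->
  divides p (\prod_(q <- s) q) ->
  exists q w, [/\ q \in s, w \is a GRing.unit & q = p * w].
Proof.
move=> pP; elim: s => [_|q s IHs /all_prime_cons[qP sP]].
  rewrite big_nil => -[w wE]; case: pP => _ /negP[].
  by apply/unitrP; exists w; rewrite mulrC -wE.
rewrite big_cons; case: (pP) => _ _ pE /pE[/(prime_assoc pP qP)[w wU qE]|/(IHs sP)].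
  by exists q, w; rewrite inE eqxx.
by case=> q' [w [q's wU qE]]; exists q', w; rewrite inE q's orbT.
Qed.

Lemma factorial_prime a : factorial_ring R -> a != 0 -> a \isn't a GRing.unit ->
  exists2 p, prime_elt p & divides p a.
Proof.
move=> facR a0 aU; have [u [[|p s] [uU sP aE]]] := facR a a0.
  by move: aU; rewrite aE big_nil mulr1 uU.
have [pP _] := (all_prime_cons p s).1 sP.
by exists p => //; exists (u * \prod_(q <- s) q); rewrite aE big_cons; ring.
Qed.

Lemma irreducible_prime a : factorial_ring R -> a != 0 -> a \isn't a GRing.unit ->
  (forall b c, a = b * c -> b \is a GRing.unit \/ c \is a GRing.unit) ->
  prime_elt a.
Proof.
move=> facR a0 aU aI; have [p pP [c aE]] := factorial_prime facR a0 aU.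
have [p0 pU pE] := pP.
have [pU'|cU] := aI p c aE; first by rewrite pU' in pU.
have dvdE b : divides p b -> divides a b.
  by case=> q ->; exists (c^-1 * q); rewrite aE -mulrA mulVKr.
split=> // b b' [q bE]; case: (pE b b').
- by exists (c * q); rewrite bE aE; ring.
- by move/dvdE; left.
- by move/dvdE; right.
Qed.

End Factorial.

Section Gauss.
Variable R : idomainType.
Implicit Types (a b c p q u : R) (s : seq R) (f g h : {poly R}).

(** The quotient of R[X] by p is (R/p)[X], a domain. Without quotients: p divides
one of the leading coefficients of g and h, and removing that leading term does
not affect the hypothesis nor the conclusion. *)
Lemma primeC p : prime_elt p -> prime_elt p%:P.
Proof.
move=> [p0 pU pE]; split; first by rewrite polyC_eq0.
  by rewrite poly_unitE coefC size_polyC p0 /= (negPf pU).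
suff dvdM k g h : (size g + size h <= k)%N -> divides p%:P (g * h) ->
    divides p%:P g \/ divides p%:P h by move=> g h; apply: dvdM.
elim: k g h => [|k IHk] g h.
  rewrite leqn0 addn_eq0 size_poly_eq0 => /andP[/eqP-> _] _.
  by left; exists 0; rewrite mulr0.
have [->|g0] := eqVneq g 0; first by left; exists 0; rewrite mulr0.
have [->|h0] := eqVneq h 0; first by right; exists 0; rewrite mulr0.
have drop (f : {poly R}) : f != 0 ->
    (size (f - lead_coef f *: 'X^((size f).-1))%R < size f)%N.
  move=> f0; have sf : (0 < size f)%N by rewrite size_poly_gt0.
  apply: (@leq_ltn_trans (size f).-1); last by rewrite prednK.
  apply/leq_sizeP => j; rewrite leq_eqVlt => /predU1P[<-|sj].
    by rewrite coefB coefZ coefXn eqxx mulr1 subrr.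
  rewrite coefB coefZ coefXn (gtn_eqF sj) mulr0 subr0 nth_default //.
  by rewrite -(prednK sf).
move=> sz [c cE].
have : divides p (lead_coef g * lead_coef h).
  by exists (lead_coef c); rewrite -lead_coefM cE lead_coefM lead_coefC.
case/pE=> -[q qE].
- case: (IHk (g - lead_coef g *: 'X^((size g).-1))%R h).
  + by rewrite -ltnS; apply: leq_trans sz; rewrite ltn_add2r drop.
  + exists (c - q *: 'X^((size g).-1) * h)%R.
    by rewrite mulrBl cE qE -!mul_polyC polyCM; ring.
  + case=> g' g'E; left; exists (g' + q *: 'X^((size g).-1))%R.
    rewrite mulrDr -g'E qE -!mul_polyC polyCM; ring.
  + by right.
- case: (IHk g (h - lead_coef h *: 'X^((size h).-1))%R).
  + by rewrite -ltnS; apply: leq_trans sz; rewrite ltn_add2l drop.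
  + exists (c - q *: 'X^((size h).-1) * g)%R.
    by rewrite mulrBr cE qE -!mul_polyC polyCM; ring.
  + by left.
  + case=> h' h'E; right; exists (h' + q *: 'X^((size h).-1))%R.
    rewrite mulrDr -h'E qE -!mul_polyC polyCM; ring.
Qed.

Definition primitive f := forall p, prime_elt p -> ~ divides p%:P f.

Hypothesis facR : factorial_ring R.

(** Gauss: the prime factors of d are removed one at a time; none of them divides f,
so each divides the cofactor of f. *)
Lemma primitive_dvd d f g : primitive f -> d != 0 ->
  divides f (d%:P * g) -> divides f g.
Proof.
move=> fP d0; have [u [s [uU sP ->]]] := facR d0.
elim: s sP {d d0} g => [_|p s IHs /all_prime_cons[pP /IHs{}IHs]] g.
  rewrite big_nil mulr1 => -[h hE]; exists (u^-1%:P * h).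
  by rewrite mulrCA -hE mulrA -polyCM mulVr // mul1r.
case=> h hE; have [p0 _ pE] := primeC pP.
case: (pE f h).
- exists (u%:P * (\prod_(q <- s) q)%:P * g).
  by rewrite -hE big_cons !polyCM; ring.
- by move/fP: pP.
- case=> h' h'E; apply: IHs; exists h'; apply: (mulfI p0).
  by rewrite [RHS]mulrCA -h'E -hE big_cons !polyCM; ring.
Qed.

(** A factorization of f over the fraction field, after clearing denominators,
descends to R with the same degrees. *)
Lemma primitive_split d f g h : d != 0 -> d%:P * f = g * h ->
  exists g' h', [/\ f = g' * h', size g' = size g & size h' = size h].
Proof.
move=> d0; have [u [s [uU sP ->]]] := facR d0.
elim: s sP {d d0} g h => [_|p s IHs /all_prime_cons[pP /IHs{}IHs]] g h.
  rewrite big_nil mulr1 => fE; exists (u^-1 *: g), h.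
  rewrite -scalerAl -fE mul_polyC scalerA mulVr // scale1r.
  rewrite size_scale //; apply: contraTneq uU => u0.
  by rewrite -unitrV u0 unitr0.
have [p0 _ pE] := primeC pP; have pn0 : p != 0 by case: pP.
rewrite big_cons => fE; case: (pE g h).
- by exists (u%:P * (\prod_(q <- s) q)%:P * f); rewrite -fE !polyCM; ring.
- case=> g' g'E; case: (IHs g' h) => [|g1 [h1 [fE1 sg sh]]].
    by apply: (mulfI p0); rewrite [RHS]mulrA -g'E -fE !polyCM; ring.
  by exists g1, h1; rewrite fE1 sg sh g'E mul_polyC size_scale.
- case=> h' h'E; case: (IHs g h') => [|g1 [h1 [fE1 sg sh]]].
    apply: (mulfI p0); rewrite [RHS]mulrCA.
    by rewrite -h'E -fE !polyCM; ring.
  by exists g1, h1; rewrite fE1 sg sh h'E mul_polyC size_scale.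
Qed.

(** Over the fraction field f is irreducible, hence coprime to g or a divisor of g;
divisibility over the fraction field is that of pseudo-division, and it descends
to R because f is primitive. *)
Lemma primitive_irreducible_prime f : (1 < size f)%N -> primitive f ->
  (forall g h, f = g * h -> (size g <= 1)%N \/ (size h <= 1)%N) ->
  prime_elt f.
Proof.
move=> sf fP fI; have f0 : f != 0 by rewrite -size_poly_gt0 ltnW.
split=> //; first by rewrite poly_unitE gtn_eqF.
have dvdP g : f %| g -> divides f g.
  case/Pdiv.Idomain.dvdpP => -[d q] /= d0 dE.
  by apply: (primitive_dvd fP d0); exists q; rewrite mul_polyC dE mulrC.
move=> g h [q ghE].
have /Pdiv.Idomain.dvdpP[[d k] /= d0 dE] : gcdp f g %| f by exact: dvdp_gcdl.
have /(primitive_split d0)[g' [h' [fE sg sh]]] : d%:P * f = gcdp f g * k.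
  by rewrite mul_polyC dE mulrC.
case: (fI g' h' fE).
- rewrite sg => s1; right; apply: dvdP.
  have cop : coprimep f g.
    by rewrite /coprimep eqn_leq s1 size_poly_gt0 gcdp_eq0 negb_and f0.
  by rewrite -(Gauss_dvdpr _ cop) ghE dvdp_mulIl.
- rewrite sh => s1; left; apply: dvdP; apply: dvdp_trans (dvdp_gcdr f g).
  have k0 : k != 0.
    apply: contra_neq f0 => k0; move/eqP: dE.
    by rewrite k0 mul0r -mul_polyC mulf_eq0 polyC_eq0 (negPf d0) => /eqP.
  have /size_poly1P[e e0 kE] : size k == 1%N by rewrite eqn_leq s1 size_poly_gt0.
  apply/Pdiv.Idomain.dvdpP; exists (e, d%:P) => //=.
  by rewrite mul_polyC dE kE mul_polyC.
Qed.

(** Each prime constant dividing f divides its leading coefficient, so the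
extraction of prime constants stops after at most as many steps as this
coefficient has prime factors. *)
Lemma primitive_part f : f != 0 ->
  exists s g, [/\ all_prime s, primitive g & f = (\prod_(p <- s) p)%:P * g].
Proof.
move=> f0; have lf0 : lead_coef f != 0 by rewrite lead_coef_eq0.
have [u [s [uU sP lE]]] := facR lf0.
have {u uU lE lf0} : exists t, \prod_(p <- s) p = lead_coef f * t.
  by exists u^-1; rewrite lE mulrC mulKr.
elim: {s}(size s) {-2}s (erefl (size s)) sP f f0 => [|k IHk] s sz sP f f0 [t tE].
  exists [::], f; rewrite big_nil mul1r; split=> // p pP [g fE].
  case: (pP) => _ /negP[]; apply/unitrP; exists (lead_coef g * t).
  suff pt : p * (lead_coef g * t) = 1 by rewrite mulrC.
  move: tE; rewrite (size0nil sz) big_nil => ->.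
  by rewrite fE lead_coefM lead_coefC mulrA.
have [fP|] := classic (primitive f).
  by exists [::], f; rewrite big_nil mul1r.
move=> fnP; have [p pnP] := not_all_ex_not _ _ fnP.
have [pP /NNPP[g fE]] := imply_to_and _ _ pnP.
have g0 : g != 0 by apply: contraNneq f0 => g0; rewrite fE g0 mulr0.
have p0 : p != 0 by case: pP.
have [q [w [qs wU qE]]] : exists q w, [/\ q \in s, w \is a GRing.unit & q = p * w].
  apply: prime_dvd_prod => //; exists (lead_coef g * t).
  by rewrite tE fE lead_coefM lead_coefC; ring.
case: (IHk (rem q s) _ _ g g0) => [||| s' [g' [s'P g'P gE]]].
- by rewrite size_rem // sz.
- by move=> x /mem_rem/sP.
- exists (t * w^-1); apply: (mulfI p0); apply: (mulIr wU).
  have sE : \prod_(j <- s) j = q * \prod_(j <- rem q s) j.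
    by rewrite (perm_big _ (perm_to_rem qs)) big_cons.
  transitivity (\prod_(j <- s) j); first by rewrite sE qE; ring.
  by rewrite tE fE lead_coefM lead_coefC -!mulrA mulVr // mulr1.
exists (p :: s'), g'; split=> //; first exact/all_prime_cons.
by rewrite fE gE big_cons polyCM mulrA.
Qed.

Theorem factorial_poly : factorial_ring {poly R}.
Proof.
suff fac k f : (size f <= k)%N -> f != 0 -> exists (u : {poly R}) (s : seq {poly R}),
    [/\ u \is a GRing.unit, all_prime s & f = u * \prod_(p <- s) p].
  by move=> f; apply: fac (leqnn _).
elim: k f => [|k IHk] f sf f0.
  by move: f0; rewrite -size_poly_gt0 ltnNge sf.
have [s [g [sP gP fE]]] := primitive_part f0.
have sz : size f = size g.
  rewrite fE mul_polyC size_scale //.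
  apply: contraNneq f0 => s0; by rewrite fE s0 mul0r.
have g0 : g != 0 by apply: contraNneq f0 => g0; rewrite fE g0 mulr0.
suff [u [t [uU tP gE]]] : exists (u : {poly R}) (t : seq {poly R}),
    [/\ u \is a GRing.unit, all_prime t & g = u * \prod_(p <- t) p].
  exists u, (map polyC s ++ t); split=> //.
    apply: all_prime_cat => // p /mapP[q /sP qP ->]; exact: primeC.
  by rewrite big_cat big_map /= fE {1}gE -rmorph_prod mulrCA.
have [s1|s1] := leqP (size g) 1.
  have [c cE] : exists c, g = c%:P by exists g`_0; rewrite -size1_polyC.
  have c0 : c != 0 by move: g0; rewrite cE polyC_eq0.
  exists g, [::]; rewrite big_nil mulr1; split=> //.
  rewrite cE poly_unitE coefC size_polyC c0 /=.
  apply: contraT => cU; have [p pP [q qE]] := factorial_prime facR c0 cU.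
  by case: (gP p pP); exists q%:P; rewrite cE qE polyCM.
have [gI|] := classic (forall a b : {poly R}, g = a * b ->
    (size a <= 1)%N \/ (size b <= 1)%N).
  exists 1, [:: g]; rewrite unitr1 big_seq1 mul1r; split=> // p.
  by rewrite inE => /eqP->; apply: primitive_irreducible_prime.
move=> gnI; have [a anI] := not_all_ex_not _ _ gnI.
have [b abnI] := not_all_ex_not _ _ anI.
have [gE /not_or_and[/negP]] := imply_to_and _ _ abnI.
rewrite -ltnNge => sa /negP; rewrite -ltnNge => sb.
have a0 : a != 0 by rewrite -size_poly_gt0 ltnW.
have b0 : b != 0 by rewrite -size_poly_gt0 ltnW.
have sg : (size a + size b = (size g).+1)%N.
  by rewrite gE size_mul // prednK // addn_gt0 (ltnW sa).
have lt_k (c e : nat) : (1 < c)%N -> (e + c = (size g).+1)%N -> (e <= k)%N.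
  move=> c1 ec; rewrite -ltnS; apply: leq_trans sf; rewrite sz -ltnS -ec.
  by rewrite -[X in (X < _)%N]addn1 ltn_add2l.
have [u [t [uU tP aE]]] := IHk a (lt_k _ _ sb sg) a0.
have sg' : (size b + size a = (size g).+1)%N by rewrite addnC.
have [u' [t' [u'U t'P bE]]] := IHk b (lt_k _ _ sa sg') b0.
exists (u * u'), (t ++ t'); split; first by rewrite unitrM uU.
  exact: all_prime_cat.
by rewrite gE aE bE big_cat /= mulrACA.
Qed.

End Gauss.

Lemma factorial_field (K : fieldType) : factorial_ring K.
Proof. by move=> a a0; exists a, [::]; rewrite unitfE a0 big_nil mulr1. Qed.

(** * Differential polynomials as a polynomial ring *)

Section MonVal.
Variables (V : choiceType) (A : comNzRingType) (x : V -> A).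
Implicit Types (mu nu : {cmonom V}) (v : V).

Definition mon_val mu : A := \prod_(v <- finsupp mu) x v ^+ mu v.

Lemma mon_valEw (D : {fset V}) mu : (finsupp mu `<=` D)%fset ->
  mon_val mu = \prod_(v <- D) x v ^+ mu v.
Proof.
move=> sD; apply: (big_fset_incl _ sD) => v _.
by rewrite -cmE_eq0 => /eqP->.
Qed.

Lemma mon_val1 : mon_val mone = 1.
Proof. by rewrite /mon_val mdom1 big_seq_fset0. Qed.

Lemma mon_valM mu nu : mon_val (mulcm mu nu) = mon_val mu * mon_val nu.
Proof.
have sD : finsupp (mulcm mu nu) = (finsupp mu `|` finsupp nu)%fset by exact: mdomD.
rewrite {1}/mon_val sD (mon_valEw (fsubsetUl _ (finsupp nu))).
rewrite (mon_valEw (fsubsetUr (finsupp mu) _)) -big_split /=.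
by apply: eq_bigr => v _; rewrite mulcmE exprD.
Qed.

Lemma mon_valU v : mon_val (ucm v) = x v.
Proof. by rewrite /mon_val mdomU big_seq_fset1 cmUU. Qed.

End MonVal.

Section MonomialPowers.
Variable V : choiceType.
Implicit Types (mu : {cmonom V}) (v : V).

Lemma expcmnS mu n : expcmn mu n.+1 = mulcm mu (expcmn mu n).
Proof. by case: n => [|n] //=; rewrite /expcmn /= mulcm0. Qed.

Lemma expcmnE mu n v : expcmn mu n v = (n * mu v)%N.
Proof. by elim: n => [|n IHn]; rewrite ?onecmE // expcmnS mulcmE IHn mulSn. Qed.

End MonomialPowers.

Section Basics.
Variables (m : nat) (K : deltaField m) (J : choiceType).
Implicit Types (p q : dpoly K J) (mu nu : {cmonom (dvar m J)}) (v : dvar m J).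

Lemma dp_mul_malg p q : p * q = ((p : {malg K[{cmonom (dvar m J)}]}) * q : {malg _[_]}).
Proof. by rewrite [LHS]/GRing.mul /= dp_mul.unlock. Qed.

Lemma dp_monoD c d mu : dp_mono (c + d) mu = dp_mono c mu + dp_mono d mu :> dpoly K J.
Proof. by rewrite dp_mono.unlock monalgUD. Qed.

Lemma dp_monoM c d mu nu :
  dp_mono c mu * dp_mono d nu = dp_mono (c * d) (mulcm mu nu) :> dpoly K J.
Proof.
rewrite dp_mul_malg dp_mono.unlock; exact: fgmulUU.
Qed.

Lemma dpE p : p = \sum_(mu <- msupp p) dp_mono p@_mu mu.
Proof. rewrite dp_mono.unlock; exact: monalgE. Qed.

Fact dC_is_zmod_morphism : zmod_morphism (@dC m K J).
Proof. by move=> c d; rewrite /dC dp_mono.unlock; apply: monalgUB. Qed.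

Fact dC_is_monoid_morphism : monoid_morphism (@dC m K J).
Proof.
split; first by rewrite /dC dp_mono.unlock; apply: mpolyC1E.
by move=> c d; rewrite /dC dp_monoM mulcm0.
Qed.

HB.instance Definition _ :=
  GRing.isZmodMorphism.Build K (dpoly K J) (@dC m K J) dC_is_zmod_morphism.
HB.instance Definition _ :=
  GRing.isMonoidMorphism.Build K (dpoly K J) (@dC m K J) dC_is_monoid_morphism.


Section Hom.
Variables (A : comNzRingType) (c : {rmorphism K -> A}) (x : dvar m J -> A).

(** The universal property: the ring morphism that extends c and sends each
variable v to x v. *)
Definition dp_hom : dpoly K J -> A := mmap c (mon_val x).

Lemma dp_homE p : dp_hom p = \sum_(mu <- msupp p) c p@_mu * mon_val x mu.
Proof. by []. Qed.

Lemma dp_hom_mono a mu : dp_hom (dp_mono a mu) = c a * mon_val x mu.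
Proof. by rewrite dp_mono.unlock; apply: mmapU. Qed.

Fact dp_hom_is_zmod_morphism : zmod_morphism dp_hom.
Proof. exact: mmap_is_additive. Qed.

HB.instance Definition _ :=
  GRing.isZmodMorphism.Build (dpoly K J) A dp_hom dp_hom_is_zmod_morphism.

Fact dp_hom_is_monoid_morphism : monoid_morphism dp_hom.
Proof.
split; first by rewrite -(rmorph1 (@dC m K J)) dp_hom_mono mon_val1 rmorph1 mulr1.
move=> p q; rewrite {1}[p]dpE {1}[q]dpE big_distrlr /= [in RHS]dp_homE [dp_hom q]dp_homE.
rewrite big_distrlr /= raddf_sum; apply: eq_bigr => mu _.
rewrite raddf_sum; apply: eq_bigr => nu _ /=.
by rewrite dp_monoM dp_hom_mono mon_valM rmorphM mulrACA.
Qed.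

HB.instance Definition _ :=
  GRing.isMonoidMorphism.Build (dpoly K J) A dp_hom dp_hom_is_monoid_morphism.

Lemma dp_homC a : dp_hom (dC J a) = c a.
Proof. by rewrite dp_hom_mono mon_val1 mulr1. Qed.

Lemma dp_homX v : dp_hom (dX K v) = x v.
Proof. by rewrite dp_hom_mono mon_valU rmorph1 mul1r. Qed.

End Hom.

Lemma dp_mono1X mu n : dp_mono 1 (expcmn mu n) = dp_mono 1 mu ^+ n :> dpoly K J.
Proof.
elim: n => [|n IHn]; first exact: (rmorph1 (@dC m K J)).
by rewrite expcmnS exprS -IHn dp_monoM mulr1.
Qed.

Lemma mon_val_dX mu : mon_val (@dX m K J) mu = dp_mono 1 mu.
Proof.
have muE : mu = \big[@mulcm _/onecm _]_(v <- finsupp mu) expcmn (ucm v) (mu v).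
  apply/eqP/cmP => w.
  rewrite (big_morph (fun nu : {cmonom _} => nu w) (id1 := 0%N) (op1 := addn)).
  - under eq_bigr => v _ do rewrite expcmnE ucmE.
    have [wmu|wmu] := boolP (w \in finsupp mu).
      rewrite (big_fsetD1 w) //= eqxx muln1 big1_fset ?addn0 // => v.
      by rewrite !inE => /andP[/negPf-> _] _; rewrite muln0.
    rewrite big1_fset => [|v vmu _]; first by apply/eqP; rewrite cmE_eq0.
    by case: eqP => [wv|]; rewrite ?muln0 //; rewrite -wv vmu in wmu.
  - by move=> ? ?; rewrite mulcmE.
  - by rewrite onecmE.
rewrite {2}muE (big_morph (fun nu => dp_mono 1 nu : dpoly K J) (id1 := 1) (op1 := *%R)).
- by apply: eq_bigr => v _; rewrite dp_mono1X.
- by move=> ? ?; rewrite dp_monoM mulr1.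
- exact: (rmorph1 (@dC m K J)).
Qed.

Lemma dp_monoE a mu : dp_mono a mu = dC J a * mon_val (@dX m K J) mu.
Proof. by rewrite mon_val_dX dp_monoM mulr1 mul0cm. Qed.

Lemma mem_dvars p v :
  reflect (exists2 mu, mu \in msupp p & v \in finsupp mu) (v \in dvars p).
Proof.
rewrite /dvars; apply: (iffP (bigfcupP _ _ _ _)) => -[mu].
  by rewrite andbT; exists mu.
by exists mu; rewrite ?andbT.
Qed.

(** Differential polynomials are generated, as a ring, by the constants and their
variables; identities between morphisms or derivations are checked there. *)
Lemma dp_ind_in (Q : dpoly K J -> Prop) p :
  (forall a, Q (dC J a)) -> (forall v, v \in dvars p -> Q (dX K v)) ->
  (forall q r, Q q -> Q r -> Q (q + r)) ->
  (forall q r, Q q -> Q r -> Q (q * r)) -> Q p.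
Proof.
move=> QC QX QD QM; rewrite [p]dpE.
have Q1 : Q 1 by move: (QC 1); rewrite rmorph1.
rewrite big_seq; apply: (big_ind Q) => // [|mu mup].
  by move: (QC 0); rewrite rmorph0.
rewrite dp_monoE; apply: (QM) => //; rewrite /mon_val big_seq.
apply: (big_ind Q) => // v vmu; elim: (mu v) => // n IHn.
by rewrite exprS; apply: (QM) => //; apply: QX; apply/mem_dvars; exists mu.
Qed.

Lemma dp_ind (Q : dpoly K J -> Prop) :
  (forall a, Q (dC J a)) -> (forall v, Q (dX K v)) ->
  (forall q r, Q q -> Q r -> Q (q + r)) ->
  (forall q r, Q q -> Q r -> Q (q * r)) -> forall p, Q p.
Proof. by move=> QC QX QD QM p; apply: dp_ind_in => // v _; apply: QX. Qed.

Lemma dp_morph_eq_in (A : comNzRingType) (g h : {rmorphism dpoly K J -> A}) p :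
  (forall a, g (dC J a) = h (dC J a)) ->
  (forall v, v \in dvars p -> g (dX K v) = h (dX K v)) -> g p = h p.
Proof.
move=> ghC ghX; apply: (@dp_ind_in (fun q => g q = h q)) => // q r gq gr.
  by rewrite !rmorphD gq gr.
by rewrite !rmorphM gq gr.
Qed.

Lemma dp_morph_eq (A : comNzRingType) (g h : {rmorphism dpoly K J -> A}) :
  (forall a, g (dC J a) = h (dC J a)) ->
  (forall v, g (dX K v) = h (dX K v)) -> forall p, g p = h p.
Proof. by move=> ghC ghX p; apply: dp_morph_eq_in. Qed.

End Basics.

(** * Irreducible differential polynomials are prime *)

Section Factoriality.
Variables (m : nat) (K : deltaField m) (J : choiceType).
Implicit Types (p q : dpoly K J) (v : dvar m J).

(** A polynomial ring R over K in the variables s, with mutually inverse maps phi and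
psi up to the variables outside s. The last field says that psi only reaches
polynomials in the variables s. *)
Record poly_model (s : seq (dvar m J)) (R : idomainType)
    (phi : {rmorphism dpoly K J -> R}) (psi : {rmorphism R -> dpoly K J}) : Prop :=
  PolyModel {
  pm_factorial : factorial_ring R;
  pm_cancel : cancel psi phi;
  pm_const : forall a, psi (phi (dC J a)) = dC J a;
  pm_var : forall v, v \in s -> psi (phi (dX K v)) = dX K v;
  pm_gen : forall (A : comNzRingType) (g h : {rmorphism dpoly K J -> A}),
    (forall a, g (dC J a) = h (dC J a)) ->
    (forall v, v \in s -> g (dX K v) = h (dX K v)) ->
    forall r, g (psi r) = h (psi r) }.

(** R is the tower K[v_1][v_2]..., so it is factorial by Gauss; phi sends the
variables outside s to 0. *)
Lemma poly_model_exists (s : seq (dvar m J)) : uniq s ->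
  exists (R : idomainType) (phi : {rmorphism dpoly K J -> R}) psi,
    @poly_model s R phi psi.
Proof.
elim: s => [_|v0 s IHs /andP[v0s /IHs[R [phi [psi []]]]]].
  exists K, (@dp_hom m K J K idfun (fun=> 0)), (@dC m K J).
  split=> // [|a|a] /=.
  - exact: factorial_field.
  - exact: dp_homC.
  - by rewrite dp_homC.
move=> facR psiK psiC psiX psiG.
pose x v : {poly R} := if v == v0 then 'X else (phi (dX K v))%:P.
pose phi' : {rmorphism dpoly K J -> {poly R}} :=
  dp_hom (polyC \o phi \o @dC m K J) x.
pose psi' : {rmorphism {poly R} -> dpoly K J} :=
  horner_eval (dX K v0) \o map_poly psi.
have psi'C r : psi' r%:P = psi r by rewrite /= map_polyC /horner_eval hornerC.
have psi'X : psi' 'X = dX K v0 by rewrite /= map_polyX /horner_eval hornerX.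
have polyE (p : {poly R}) : p = \sum_(i < size p) (p`_i)%:P * 'X^i.
  by rewrite -[LHS]coefK poly_def; apply: eq_bigr => i _; rewrite mul_polyC.
exists {poly R}, phi', psi'; split.
- exact: factorial_poly.
- move=> p; rewrite [in RHS](polyE p) [in LHS](polyE p) !rmorph_sum.
  apply: eq_bigr => i _; rewrite !rmorphM !rmorphXn psi'C psi'X.
  rewrite [phi' (dX _ _)]dp_homX /x eqxx; congr (_ * _).
  rewrite -[in RHS](psiK p`_i).
  apply: (psiG _ phi' (polyC \o phi)) => [a|v vs] /=; first by rewrite dp_homC.
  by rewrite dp_homX /x; case: eqP => // vv0; rewrite -vv0 vs in v0s.
- by move=> a; rewrite [phi' _]dp_homC -[RHS]psiC -psi'C.
- move=> v; rewrite inE [phi' _]dp_homX /x; case: eqP => [->|_ /psiX] //.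
  by rewrite psi'C.
- move=> A g h ghC ghX r; rewrite (polyE r) !rmorph_sum.
  apply: eq_bigr => i _; rewrite !rmorphM !rmorphXn psi'C psi'X.
  rewrite ghX ?inE ?eqxx //; congr (_ * _); apply: psiG => // v vs.
  by apply: ghX; rewrite inE vs orbT.
Qed.

Lemma poly_model_for (D : {fset dvar m J}) :
  exists (R : idomainType) (phi : {rmorphism dpoly K J -> R})
         (psi : {rmorphism R -> dpoly K J}),
    [/\ factorial_ring R, cancel psi phi
      & forall p, (dvars p `<=` D)%fset -> psi (phi p) = p].
Proof.
have [R [phi [psi [facR psiK psiC psiX _]]]] := poly_model_exists (fset_uniq D).
exists R, phi, psi; split=> // p /fsubsetP pD.
apply: (@dp_morph_eq_in _ _ _ _ (psi \o phi) idfun) => //= v /pD; exact: psiX.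
Qed.

Lemma dp_mulf_eq0 p q : p * q = 0 -> p = 0 \/ q = 0.
Proof.
have [R [phi [psi [_ _ phiK]]]] := poly_model_for (dvars p `|` dvars q)%fset.
move/(congr1 phi); rewrite rmorphM rmorph0 => /eqP.
rewrite mulf_eq0 => /orP[]/eqP /(congr1 psi); rewrite rmorph0 phiK.
- by left.
- exact: fsubsetUl.
- by right.
- exact: fsubsetUr.
Qed.

Lemma dp_mulf_neq0 p q : p != 0 -> q != 0 -> p * q != 0.
Proof.
by move=> p0 q0; apply/eqP => /dp_mulf_eq0[] /eqP; apply/negP.
Qed.

Lemma dp_mulfI p : p != 0 -> injective ( *%R p).
Proof.
move=> p0 q r /eqP; rewrite -subr_eq0 -mulrBr => /eqP/dp_mulf_eq0[/eqP|/eqP].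
  by rewrite (negPf p0).
by rewrite subr_eq0 => /eqP.
Qed.

(** Only finitely many variables occur in p, q and r: in the factorial ring of
polynomials in these variables, irreducible elements are prime. *)
Lemma dp_irreducible_prime p q r : irreducible p ->
  divides p (q * r) -> divides p q \/ divides p r.
Proof.
move=> [p0 pU pI] [w wE].
have [R [phi [psi [facR psiK phiK]]]] :=
  poly_model_for (dvars p `|` (dvars q `|` dvars r))%fset.
have pK : psi (phi p) = p by apply: phiK; apply: fsubsetUl.
have qK : psi (phi q) = q.
  by apply: phiK; apply: fsubset_trans (fsubsetUr _ _); apply: fsubsetUl.
have rK : psi (phi r) = r.
  by apply: phiK; apply: fsubset_trans (fsubsetUr _ _); apply: fsubsetUr.
have unit_phi a : invertible (psi a) -> a \is a GRing.unit.
  case=> b ab; apply/unitrP; exists (phi b).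
  have: a * phi b = 1 by rewrite -[a]psiK -rmorphM ab rmorph1.
  by split=> //; rewrite mulrC.
have /irreducible_prime : factorial_ring R by [].
move=> /(_ (phi p)) [] => [|||_ _ pP].
- by apply: contra_not_neq p0 => phi0; rewrite -pK phi0 rmorph0.
- apply/negP => /unitrP[b [bp _]]; apply: pU; exists (psi b).
  by rewrite -{1}pK -rmorphM mulrC bp rmorph1.
- move=> b c bc; have : p = psi b * psi c by rewrite -rmorphM -bc pK.
  by case/pI=> /unit_phi; [left|right].
case: (pP (phi q) (phi r)) => [|[t tE]|[t tE]].
- by exists (phi w); rewrite -!rmorphM wE.
- by left; exists (psi t); rewrite -qK tE rmorphM pK.
- by right; exists (psi t); rewrite -rK tE rmorphM pK.
Qed.

End Factoriality.

(** * Weights *)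

Section Weights.
Variables (m : nat) (K : deltaField m) (J : choiceType).
Implicit Types (p q : dpoly K J) (mu nu : {cmonom (dvar m J)}) (v : dvar m J).
Implicit Types (w : dvar m J -> nat).

(** The weight of a monomial when v has weight w v. By choosing w, the same notion
serves for the total degree, the degree in some variables, the total order of
derivation, and the fact of not containing some variables. *)
Definition wt w mu : nat := (\sum_(v <- finsupp mu) mu v * w v)%N.

Lemma wtEw w (D : {fset dvar m J}) mu : (finsupp mu `<=` D)%fset ->
  wt w mu = (\sum_(v <- D) mu v * w v)%N.
Proof.
move=> sD; apply: (big_fset_incl _ sD) => v _.
by rewrite -cmE_eq0 => /eqP->.
Qed.

Lemma wt1 w : wt w mone = 0%N.
Proof. by rewrite /wt mdom1 big_seq_fset0. Qed.

Lemma wtM w mu nu : wt w (mulcm mu nu) = (wt w mu + wt w nu)%N.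
Proof.
have sD : finsupp (mulcm mu nu) = (finsupp mu `|` finsupp nu)%fset by exact: mdomD.
rewrite {1}/wt sD (wtEw _ (fsubsetUl _ (finsupp nu))).
rewrite (wtEw _ (fsubsetUr (finsupp mu) _)) -big_split /=.
by apply: eq_bigr => v _; rewrite mulcmE mulnDl.
Qed.

Lemma wtU w v : wt w (ucm v) = w v.
Proof. by rewrite /wt mdomU big_seq_fset1 cmUU mul1n. Qed.

Lemma wt_indicator (Q : pred (dvar m J)) mu :
  (wt (fun v => ~~ Q v) mu < 1)%N <-> (forall v, v \in finsupp mu -> Q v).
Proof.
rewrite ltnS leqn0; split=> [|muQ].
  rewrite /wt big_seq sum_nat_seq_eq0 => /allP/= all0 v vmu.
  have := all0 v vmu; rewrite vmu muln_eq0 cmE_eq0 vmu /=.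
  by rewrite eqb0 negbK.
by rewrite /wt big_seq big1 // => v /muQ ->; rewrite muln0.
Qed.

Lemma mcoeff_mono a mu nu : (dp_mono a mu : dpoly K J)@_nu = a *+ (mu == nu).
Proof. by rewrite dp_mono.unlock mcoeffU. Qed.

Lemma mcoeff_dCM (a : K) p mu : (dC J a * p)@_mu = a * p@_mu.
Proof. by rewrite dp_mul_malg /dC dp_mono.unlock mcoeffCM. Qed.

(** Multiplying v by X^(w v) makes the coefficient of X^k the part of weight k; this
reduces statements on weights to statements on degrees in X. *)
Definition grade w : {rmorphism dpoly K J -> {poly dpoly K J}} :=
  dp_hom (polyC \o @dC m K J) (fun v => (dX K v)%:P * 'X^(w v)).

Lemma grade_mono w a mu :
  grade w (dp_mono a mu) = (dp_mono a mu)%:P * 'X^(wt w mu).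
Proof.
rewrite /grade /= dp_hom_mono dp_monoE rmorphM -mulrA; congr (_ * _).
rewrite /wt /mon_val rmorph_prod expr_sum -big_split /=.
by apply: eq_bigr => v _; rewrite exprMn rmorphXn /= -exprM mulnC.
Qed.

Lemma mcoeff_grade w p k mu :
  (grade w p)`_k@_mu = p@_mu *+ (wt w mu == k).
Proof.
rewrite [p in LHS]dpE rmorph_sum coef_sum raddf_sum /=.
under eq_bigr => nu _ do rewrite grade_mono coefCM coefXn.
have [mup|mup] := boolP (mu \in msupp p); last first.
  rewrite (mcoeff_outdom mup) mul0rn big1_fset // => nu nup _.
  case: eqP => _; rewrite ?mulr0 ?mulr1 ?mcoeff0 // mcoeff_mono.
  by case: eqP => // numu; rewrite numu (negPf mup) in nup.
rewrite (big_fsetD1 mu) //= big1_fset => [|nu].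
  rewrite addr0 eq_sym; case: eqP => _; rewrite ?mulr0 ?mcoeff0 //.
  by rewrite mulr1 mcoeff_mono eqxx.
rewrite !inE => /andP[numu _] _.
by case: eqP => _; rewrite ?mulr0 ?mulr1 ?mcoeff0 // mcoeff_mono (negPf numu).
Qed.

(** The strict bound makes wlt w 0 characterize the zero polynomial, and wlt w 1 the
polynomials free of the variables of positive weight. *)
Definition wlt w n p := forall mu, mu \in msupp p -> (wt w mu < n)%N.

Lemma wltP w n p : wlt w n p <-> (size (grade w p) <= n)%N.
Proof.
split=> [pn|/leq_sizeP pn mu mup].
  apply/leq_sizeP => k nk; apply/malgP => mu; rewrite mcoeff_grade mcoeff0.
  case: (msuppP p mu) => [/pn ltn|]; last by rewrite mul0rn.
  by rewrite ltn_eqF // (leq_trans ltn).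
rewrite ltnNge; apply/negP => /pn /(congr1 (fun q : dpoly K J => q@_mu)).
rewrite mcoeff_grade mcoeff0 eqxx mulr1n => /eqP.
by rewrite mcoeff_eq0 mup.
Qed.

Lemma grade_eq0 w p : (grade w p == 0) = (p == 0).
Proof.
apply/eqP/eqP => [p0|->]; last exact: rmorph0.
apply/malgP => mu; have := mcoeff_grade w p (wt w mu) mu.
by rewrite p0 coef0 eqxx mulr1n => <-; rewrite !mcoeff0.
Qed.

Definition wdeg w p := (size (grade w p)).-1.

Lemma wlt_wdeg w n p : p != 0 -> wlt w n p <-> (wdeg w p < n)%N.
Proof.
move=> p0; rewrite wltP /wdeg prednK // size_poly_gt0.
by rewrite grade_eq0.
Qed.

Lemma wdegM w p q : p != 0 -> q != 0 -> wdeg w (p * q) = (wdeg w p + wdeg w q)%N.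
Proof.
move=> p0 q0; rewrite /wdeg rmorphM size_proper_mul; last first.
  by apply: dp_mulf_neq0; rewrite lead_coef_eq0 grade_eq0.
have pred_add a b : (0 < a -> 0 < b -> (a + b).-1.-1 = a.-1 + b.-1)%N.
  by case: a b => [|a] [|b] // _ _; rewrite addSn addnS.
by apply: pred_add; rewrite size_poly_gt0 grade_eq0.
Qed.

Lemma wlt0 w n : wlt w n 0.
Proof. by move=> mu; rewrite msupp0 inE. Qed.

Lemma wltW w n k p : (n <= k)%N -> wlt w n p -> wlt w k p.
Proof. by move=> nk pn mu /pn/leq_trans; apply. Qed.

Lemma wltD w n p q : wlt w n p -> wlt w n q -> wlt w n (p + q).
Proof.
move=> pn qn mu /(fsubsetP (msuppD_le p q)); rewrite in_fsetU => /orP[/pn|/qn] //.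
Qed.

Lemma wltN w n p : wlt w n p -> wlt w n (- p).
Proof. by move=> pn mu; rewrite msuppN => /pn. Qed.

Lemma wltB w n p q : wlt w n p -> wlt w n q -> wlt w n (p - q).
Proof. by move=> pn qn; apply: wltD => //; apply: wltN. Qed.

Lemma wlt_sum w n (I : eqType) (r : seq I) (G : I -> dpoly K J) :
  (forall i, i \in r -> wlt w n (G i)) -> wlt w n (\sum_(i <- r) G i).
Proof.
move=> Gn; rewrite big_seq; apply: (big_ind (wlt w n)) => //.
- exact: wlt0.
- exact: wltD.
Qed.

Lemma wlt_mono w a mu : wlt w (wt w mu).+1 (dp_mono a mu : dpoly K J).
Proof.
move=> nu; rewrite -mcoeff_neq0 mcoeff_mono.
by case: (mu =P nu) => [->|_] //; rewrite mulr0n eqxx.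
Qed.

Lemma wltC w a : wlt w 1 (dC J a).
Proof. by have := @wlt_mono w a mone; rewrite wt1. Qed.

Lemma wlt1 w : wlt w 1 (1 : dpoly K J).
Proof. by rewrite -(rmorph1 (@dC m K J)); apply: wltC. Qed.

Lemma wltX w v : wlt w (w v).+1 (dX K v).
Proof. by have := @wlt_mono w 1 (ucm v); rewrite wtU. Qed.

Lemma wltM w n k p q : wlt w n.+1 p -> wlt w k q -> wlt w (n + k) (p * q).
Proof.
move=> pn qk; rewrite [p]dpE [q]dpE big_distrlr /=.
apply: wlt_sum => mu mup; apply: wlt_sum => nu nuq.
rewrite dp_monoM; apply: wltW (@wlt_mono _ _ _).
by rewrite wtM -addnS leq_add //; [apply: pn | apply: qk].
Qed.

Lemma wlt_dvars (Q : pred (dvar m J)) p :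
  wlt (fun v => ~~ Q v) 1 p <-> (forall v, v \in dvars p -> Q v).
Proof.
split=> [pQ v /mem_dvars[mu /pQ/wt_indicator]|pQ mu mup]; first exact.
by apply/wt_indicator => v vmu; apply: pQ; apply/mem_dvars; exists mu.
Qed.

Section Filtration.
Variables (A : comNzRingType) (L : nat -> A -> Prop).
Hypothesis LW : forall i j a, (i <= j)%N -> L i a -> L j a.
Hypothesis L0 : forall i, L i 0.
Hypothesis LD : forall i a b, L i a -> L i b -> L i (a + b).
Hypothesis L1 : L 0%N 1.
Hypothesis LM : forall i j a b, L i a -> L j b -> L (i + j)%N (a * b).

Lemma filtration_mon_val w x mu : (forall v, v \in finsupp mu -> L (w v) (x v)) ->
  L (wt w mu) (mon_val x mu).
Proof.
move=> Lx; rewrite /wt /mon_val big_seq [X in L _ X]big_seq.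
apply: (big_ind2 L) => // [i a j b|v vmu]; first exact: LM.
by elim: (mu v) => [|k IHk]; rewrite ?mul0n // mulSn exprS; apply: LM => //; apply: Lx.
Qed.

(** A filtration of the target ring that is compatible with the weights of the
variables is compatible with the weights of all polynomials. *)
Lemma filtration_hom w (c : {rmorphism K -> A}) x n p :
  (forall a, L 0%N (c a)) -> (forall v, v \in dvars p -> L (w v) (x v)) ->
  wlt w n.+1 p -> L n (dp_hom c x p).
Proof.
move=> Lc Lx pn; rewrite dp_homE big_seq; apply: (big_ind (L n)) => //.
  by move=> a b; apply: LD.
move=> mu mup; apply: (@LW (0 + wt w mu)%N); first by rewrite -ltnS; apply: pn.
apply: LM => //; apply: filtration_mon_val => v vmu; apply: Lx.
by apply/mem_dvars; exists mu.
Qed.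

End Filtration.

Lemma wlt_const p : wlt (fun=> 1%N) 1 p -> exists a, p = dC J a.
Proof.
move=> p1; exists p@_mone; apply/malgP => mu; rewrite mcoeff_mono.
case: (mone =P mu) => [<-//|mu1]; rewrite mulr0n; apply: mcoeff_outdom.
apply/negP => /p1; rewrite /wt ltnS leqn0 big_seq sum_nat_seq_eq0 => /allP/= all0.
case: mu1; apply/eqP/cmP => v; rewrite cm1; apply/esym/eqP; rewrite cmE_eq0.
by apply/negP => vmu; move: (all0 v vmu); rewrite vmu muln1 cmE_eq0 vmu.
Qed.

Lemma dC_invertible (a : K) : a != 0 -> invertible (dC J a).
Proof.
by move=> a0; exists (dC J a^-1); rewrite -rmorphM mulfV // rmorph1.
Qed.

End Weights.

(** * Derivations and substitutions *)

Section DeltaFieldFacts.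
Variables (m : nat) (K : deltaField m).

Lemma df_der1 (i : 'I_m) : df_der i (1 : K) = 0.
Proof.
apply: (addrI (df_der i (1 : K))); rewrite addr0.
by rewrite -[in RHS](mul1r 1) df_derM mulr1 mul1r.
Qed.

End DeltaFieldFacts.

Section MonomialExtension.
Variables (m : nat) (K : deltaField m) (J : choiceType).
Implicit Types (p q : dpoly K J) (mu nu : {cmonom (dvar m J)}) (v : dvar m J).
Variable phi : K -> {cmonom (dvar m J)} -> dpoly K J.
Hypothesis phiD : forall a b mu, phi (a + b) mu = phi a mu + phi b mu.

(** The additive extension of a map given on the terms a mu. Both the partial
derivatives and the derivation of the coefficients have this form, and the
Leibniz rule has to be checked on terms only. *)
Definition mon_ext p : dpoly K J := \sum_(mu <- msupp p) phi p@_mu mu.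

Let phi0 mu : phi 0 mu = 0.
Proof. by apply: (addrI (phi 0 mu)); rewrite -phiD !addr0. Qed.

Lemma mon_extEw (D : {fset {cmonom (dvar m J)}}) p : (msupp p `<=` D)%fset ->
  mon_ext p = \sum_(mu <- D) phi p@_mu mu.
Proof.
move=> sD; rewrite /mon_ext; apply: (big_fset_incl _ sD) => mu _ /mcoeff_outdom->.
exact: phi0.
Qed.

Lemma mon_extD p q : mon_ext (p + q) = mon_ext p + mon_ext q.
Proof.
rewrite (mon_extEw (msuppD_le p q)) (mon_extEw (fsubsetUl _ (msupp q))).
rewrite (mon_extEw (fsubsetUr (msupp p) _)) -big_split /=.
by apply: eq_bigr => mu _; rewrite mcoeffD phiD.
Qed.

Lemma mon_ext0 : mon_ext 0 = 0.
Proof. by rewrite /mon_ext msupp0 big_seq_fset0. Qed.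

Lemma mon_ext_sum (I : Type) (r : seq I) (G : I -> dpoly K J) :
  mon_ext (\sum_(i <- r) G i) = \sum_(i <- r) mon_ext (G i).
Proof. exact: (big_morph mon_ext mon_extD mon_ext0). Qed.

Lemma mon_ext_mono a mu : mon_ext (dp_mono a mu) = phi a mu.
Proof.
rewrite (@mon_extEw [fset mu]%fset).
  by rewrite big_seq_fset1 mcoeff_mono eqxx.
by rewrite dp_mono.unlock; apply: msuppU_le.
Qed.

Hypothesis phiM : forall a b mu nu,
  phi (a * b) (mulcm mu nu) = phi a mu * dp_mono b nu + dp_mono a mu * phi b nu.

Lemma mon_extM p q : mon_ext (p * q) = mon_ext p * q + p * mon_ext q.
Proof.
have -> : mon_ext p * q =
    \sum_(mu <- msupp p) \sum_(nu <- msupp q) phi p@_mu mu * dp_mono q@_nu nu.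
  by rewrite {1}/mon_ext {1}[q]dpE big_distrlr.
have -> : p * mon_ext q =
    \sum_(mu <- msupp p) \sum_(nu <- msupp q) dp_mono p@_mu mu * phi q@_nu nu.
  by rewrite {1}/mon_ext {1}[p]dpE big_distrlr.
rewrite [p in LHS]dpE [q in LHS]dpE big_distrlr /= mon_ext_sum -big_split /=.
apply: eq_bigr => mu _; rewrite mon_ext_sum -big_split /=.
by apply: eq_bigr => nu _; rewrite dp_monoM mon_ext_mono phiM.
Qed.

End MonomialExtension.

Section Derivations.
Variables (m : nat) (K : deltaField m) (J : choiceType).
Implicit Types (p q : dpoly K J) (mu nu : {cmonom (dvar m J)}) (v : dvar m J).

Let phiP v (a : K) mu : dpoly K J := dp_mono (a *+ mu v) (divcm mu (ucm v)).

Let phiPD v a b mu : phiP v (a + b) mu = phiP v a mu + phiP v b mu.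
Proof. by rewrite /phiP mulrnDl dp_monoD. Qed.

Lemma dp_mono0 mu : dp_mono 0 mu = 0 :> dpoly K J.
Proof. by rewrite dp_mono.unlock monalgU0. Qed.

Let phiP_mul v a b mu nu : phiP v (a * b) (mulcm mu nu) =
  phiP v a mu * dp_mono b nu + dp_mono a mu * phiP v b nu.
Proof.
have half c d mu' nu' : dp_mono (c * d *+ mu' v) (divcm (mulcm mu' nu') (ucm v))
    = phiP v c mu' * dp_mono d nu'.
  rewrite dp_monoM mulrnAl; have [mu0|mu0] := posnP (mu' v).
    by rewrite mu0 !dp_mono0.
  congr dp_mono; apply/eqP/cmP => u.
  rewrite !(divcmE, mulcmE, ucmE); case: eqP => [<-|_]; last by rewrite !subn0.
  by rewrite -addnBAC.
rewrite {1}/phiP mulcmE mulrnDr dp_monoD half; congr (_ + _).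
by rewrite [RHS]mulrC -half (mulrC b) (mulcmC nu).
Qed.

Lemma partialD v p q : partial v (p + q) = partial v p + partial v q.
Proof. exact: (mon_extD (@phiPD v)). Qed.

Lemma partialM v p q : partial v (p * q) = partial v p * q + p * partial v q.
Proof. exact: (mon_extM (@phiPD v) (@phiP_mul v)). Qed.

Lemma partial_mono v a mu :
  partial v (dp_mono a mu) = dp_mono (a *+ mu v) (divcm mu (ucm v)) :> dpoly K J.
Proof. exact: (mon_ext_mono (@phiPD v)). Qed.

Lemma partialC v (a : K) : partial v (dC J a) = 0 :> dpoly K J.
Proof. by rewrite partial_mono cm1 mulr0n dp_mono0. Qed.

Lemma partialX v w : partial v (dX K w) = (v == w)%:R :> dpoly K J.
Proof.
rewrite partial_mono cmU eq_sym; case: eqP => [->|_]; last exact: dp_mono0.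
rewrite mulr1n -(rmorph1 (@dC m K J)) /dC; congr dp_mono.
by apply/eqP/cmP => u; rewrite divcmE onecmE subnn.
Qed.

Lemma partial_notin v p : v \notin dvars p -> partial v p = 0.
Proof.
move=> vp; rewrite /partial big1_fset // => mu mup _.
suff /eqP-> : mu v == 0%N by rewrite mulr0n dp_mono0.
by rewrite cmE_eq0; apply: contra vp => vmu; apply/mem_dvars; exists mu.
Qed.

Variable i : 'I_m.

Let phiC (a : K) mu : dpoly K J := dp_mono (df_der i a) mu.

Let phiCD a b mu : phiC (a + b) mu = phiC a mu + phiC b mu.
Proof. by rewrite /phiC df_derD dp_monoD. Qed.

Let phiC_mul a b mu nu : phiC (a * b) (mulcm mu nu) =
  phiC a mu * dp_mono b nu + dp_mono a mu * phiC b nu.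
Proof. by rewrite /phiC df_derM dp_monoD !dp_monoM. Qed.

Let shift v : dpoly K J := dX K (v.1, v.2 + theta_delta i).

Lemma dp_derEw (D : {fset dvar m J}) p : (dvars p `<=` D)%fset ->
  dp_der i p = mon_ext phiC p + \sum_(v <- D) partial v p * shift v.
Proof.
move=> sD; rewrite /dp_der; congr (_ + _); apply: (big_fset_incl _ sD) => v _ vp.
by rewrite partial_notin // mul0r.
Qed.

Lemma dp_derD p q : dp_der i (p + q) = dp_der i p + dp_der i q.
Proof.
pose D := (dvars p `|` dvars q `|` dvars (p + q)%R)%fset.
rewrite !(@dp_derEw D) ?fsubsetUr // /D; last first.
- by rewrite -fsetUA fsubsetUl.
- by rewrite (fsetUC (dvars p)) -fsetUA fsubsetUl.
rewrite mon_extD // addrACA; congr (_ + _); rewrite -big_split /=.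
by apply: eq_bigr => v _; rewrite partialD mulrDl.
Qed.

Lemma dp_derM p q : dp_der i (p * q) = dp_der i p * q + p * dp_der i q.
Proof.
pose D := (dvars p `|` dvars q `|` dvars (p * q)%R)%fset.
rewrite !(@dp_derEw D) ?fsubsetUr // /D; last first.
- by rewrite -fsetUA fsubsetUl.
- by rewrite (fsetUC (dvars p)) -fsetUA fsubsetUl.
rewrite mon_extM // mulrDl mulrDr addrACA; congr (_ + _).
rewrite mulr_suml mulr_sumr -big_split /=.
by apply: eq_bigr => v _; rewrite partialM mulrDl mulrAC !mulrA.
Qed.

Lemma dvarsC (a : K) : dvars (dC J a) = fset0 :> {fset dvar m J}.
Proof.
apply/fsetP => v; rewrite inE; apply/mem_dvars => -[mu].
rewrite -mcoeff_neq0 mcoeff_mono.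
case: (mone =P mu) => [<-|_]; last by rewrite mulr0n eqxx.
by rewrite mdom1 inE.
Qed.

Lemma dvarsX v : dvars (dX K v) = [fset v]%fset :> {fset dvar m J}.
Proof.
apply/fsetP => u; rewrite inE; apply/mem_dvars/eqP => [[mu]|->].
  rewrite -mcoeff_neq0 mcoeff_mono.
  case: (ucm v =P mu) => [<-|_]; last by rewrite mulr0n eqxx.
  by rewrite mdomU inE => _ /eqP.
exists (ucm v); last by rewrite mdomU inE.
by rewrite -mcoeff_neq0 mcoeff_mono eqxx oner_neq0.
Qed.

Lemma dp_derC (a : K) : dp_der i (dC J a) = dC J (df_der i a).
Proof.
rewrite (@dp_derEw fset0) ?dvarsC // big_seq_fset0 addr0.
exact: (mon_ext_mono phiCD).
Qed.

Lemma dp_derX v : dp_der i (dX K v) = dX K (v.1, v.2 + theta_delta i).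
Proof.
rewrite (@dp_derEw [fset v]%fset) ?dvarsX // big_seq_fset1 partialX eqxx mul1r.
rewrite (mon_ext_mono phiCD) /phiC df_der1.
by rewrite dp_mono0 add0r.
Qed.

Lemma dp_der0 : dp_der i 0 = 0 :> dpoly K J.
Proof. by apply: (addrI (dp_der i (0 : dpoly K J))); rewrite -dp_derD !addr0. Qed.

End Derivations.

(** Both sides satisfy the same second-order Leibniz rule and agree on constants
and variables. *)
Lemma dp_der_comm (m : nat) (K : deltaField m) (J : choiceType) (i j : 'I_m)
  (p : dpoly K J) : dp_der i (dp_der j p) = dp_der j (dp_der i p).
Proof.
elim/dp_ind: p => [a|v|p q IHp IHq|p q IHp IHq].
- by rewrite !dp_derC df_derC.
- by rewrite !dp_derX /= addrAC.
- by rewrite (dp_derD j p) (dp_derD i p) (dp_derD i (dp_der j p)) IHp IHq dp_derD.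
- have E a b : dp_der a (dp_der b (p * q)) =
      dp_der a (dp_der b p) * q + dp_der b p * dp_der a q
      + (dp_der a p * dp_der b q + p * dp_der a (dp_der b q)).
    by rewrite (dp_derM b p) (dp_derD a (dp_der b p * q)) (dp_derM a _ q) (dp_derM a p).
  by rewrite (E i j) (E j i) IHp IHq; apply: addrACA.
Qed.

Section ThetaMonoid.
Variable m : nat.
Implicit Types (e : Theta m) (i j : 'I_m).

Lemma thetaDE e e' i : (e + e') i = (e i + e' i)%N.
Proof. by rewrite ffunE. Qed.

Lemma theta_deltaE i j : theta_delta i j = (j == i) :> nat.
Proof. by rewrite ffunE. Qed.

Lemma theta_ordD e e' : theta_ord (e + e') = (theta_ord e + theta_ord e')%N.
Proof. by rewrite /theta_ord -big_split; apply: eq_bigr => i _; rewrite ffunE. Qed.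

Lemma theta_ord_delta i : theta_ord (theta_delta i) = 1%N.
Proof.
rewrite /theta_ord (bigD1 i) //= ffunE eqxx big1 ?addn0 // => j ji.
by rewrite ffunE (negPf ji).
Qed.

Lemma theta_ord0 : theta_ord (0 : Theta m) = 0%N.
Proof. by rewrite /theta_ord big1 // => i _; rewrite ffunE. Qed.

Lemma theta_succ e : e != 0 -> exists e' i, e = e' + theta_delta i.
Proof.
move=> e0; have [i ei|all0] := pickP (fun i => e i != 0%N).
  exists [ffun j => e j - (j == i)]%N, i; apply/ffunP => j.
  rewrite thetaDE theta_deltaE ffunE subnK //.
  by case: eqP => [->|//]; rewrite lt0n.
by case/eqP: e0; apply/ffunP => i; rewrite ffunE; apply/eqP; move/negbFE: (all0 i).
Qed.

Lemma theta_ind (P : Theta m -> Prop) :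
  P 0 -> (forall e i, P e -> P (e + theta_delta i)) -> forall e, P e.
Proof.
move=> P0 PS e; elim: {e}(theta_ord e) {-2}e (leqnn (theta_ord e)) => [|k IHk] e.
  have [->//|/theta_succ[e' [i ->]]] := eqVneq e 0.
  by rewrite theta_ordD theta_ord_delta addn1.
have [->//|/theta_succ[e' [i ->]]] := eqVneq e 0.
by rewrite theta_ordD theta_ord_delta addn1 => /IHk; apply: PS.
Qed.

Variables (A : comNzRingType) (D : 'I_m -> A -> A).

Lemma theta_app0 a : theta_app D 0 a = a.
Proof.
by rewrite /theta_app; elim: (enum _) => //= i s ->; rewrite ffunE.
Qed.

Hypothesis DC : forall i j a, D i (D j a) = D j (D i a).

(** The operators commute, so an additional D i can be moved to the front. *)
Lemma theta_appS e i a : theta_app D (e + theta_delta i) a = D i (theta_app D e a).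
Proof.
rewrite /theta_app.
have iterC j k b : iter k (D j) (D i b) = D i (iter k (D j) b).
  by elim: k => //= k ->.
have noti s : i \notin s -> foldr (fun j => iter ((e + theta_delta i)%R j) (D j)) a s
    = foldr (fun j => iter (e j) (D j)) a s.
  elim: s => //= j s IHs; rewrite inE negb_or => /andP[ij /IHs->].
  by rewrite thetaDE theta_deltaE eq_sym (negPf ij) addn0.
have: i \in enum 'I_m by rewrite mem_enum.
elim: (enum _) (enum_uniq 'I_m) => //= j s IHs /andP[js us].
rewrite inE => /predU1P[ij|iS].
  by rewrite -ij in js *; rewrite noti // thetaDE theta_deltaE eqxx addn1.
rewrite IHs // iterC; congr (D i _).
rewrite thetaDE theta_deltaE; case: eqP => [ji|_]; last by rewrite addn0.
by rewrite ji iS in js.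
Qed.

End ThetaMonoid.

Section Substitution.
Variables (m : nat) (K : deltaField m) (J J' : choiceType).
Implicit Types (x : J -> dpoly K J') (p q : dpoly K J).

Lemma theta_app_dX (L : choiceType) e (v : dvar m L) :
  theta_app (@dp_der m K L) e (dX K v) = dX K (v.1, v.2 + e).
Proof.
elim/theta_ind: e => [|e i IHe]; first by rewrite theta_app0 addr0; case: v.
rewrite theta_appS; last exact: dp_der_comm.
by rewrite IHe dp_derX addrA.
Qed.

Lemma theta_app_dY (L : choiceType) e (j : L) :
  theta_app (@dp_der m K L) e (dY K j) = dX K (j, e).
Proof. by rewrite theta_app_dX add0r. Qed.

Fact dp_subst_is_zmod_morphism x : zmod_morphism (dp_subst x).
Proof. exact: dp_hom_is_zmod_morphism. Qed.

Fact dp_subst_is_monoid_morphism x : monoid_morphism (dp_subst x).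
Proof. exact: dp_hom_is_monoid_morphism. Qed.

HB.instance Definition _ x :=
  GRing.isZmodMorphism.Build (dpoly K J) (dpoly K J') (dp_subst x)
    (dp_subst_is_zmod_morphism x).
HB.instance Definition _ x :=
  GRing.isMonoidMorphism.Build (dpoly K J) (dpoly K J') (dp_subst x)
    (dp_subst_is_monoid_morphism x).

Lemma dp_substC x (a : K) : dp_subst x (dC J a) = dC J' a.
Proof. exact: dp_homC. Qed.

Lemma dp_substX x v :
  dp_subst x (dX K v) = theta_app (@dp_der m K J') v.2 (x v.1).
Proof. exact: dp_homX. Qed.

Lemma dp_subst_der x i p : dp_subst x (dp_der i p) = dp_der i (dp_subst x p).
Proof.
elim/dp_ind: p => [a|v|p q IHp IHq|p q IHp IHq].
- by rewrite dp_derC !dp_substC dp_derC.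
- rewrite dp_derX !dp_substX; apply: theta_appS; exact: dp_der_comm.
- rewrite (dp_derD i p q) (rmorphD (dp_subst x) p q) (dp_derD i (dp_subst x p)).
  by rewrite -IHp -IHq -rmorphD.
- rewrite (dp_derM i p q) (rmorphM (dp_subst x) p q) (dp_derM i (dp_subst x p)).
  by rewrite -IHp -IHq rmorphD !rmorphM.
Qed.

Lemma dp_substY x j : dp_subst x (dY K j) = x j.
Proof. by rewrite dp_substX theta_app0. Qed.

HB.instance Definition _ (r : J -> J') :=
  GRing.RMorphism.copy (dp_rename r) (dp_subst (fun j => dY K (r j))).

Lemma dp_renameC (r : J -> J') (a : K) : dp_rename r (dC J a) = dC J' a :> dpoly K J'.
Proof. exact: dp_substC. Qed.

Lemma dp_renameX (r : J -> J') v : dp_rename r (dX K v) = dX K (r v.1, v.2).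
Proof. by rewrite [LHS]dp_substX theta_app_dY. Qed.

Lemma dp_rename_der (r : J -> J') i p :
  dp_rename r (dp_der i p) = dp_der i (dp_rename r p).
Proof. exact: dp_subst_der. Qed.

End Substitution.

(** * Initials and separants *)

Section DvarsIn.
Variables (m : nat) (K : deltaField m) (J : choiceType).
Implicit Types (p q : dpoly K J) (v : dvar m J) (Q : pred (dvar m J)).

Definition vars_in Q p := forall v, v \in dvars p -> Q v.

Lemma vars_in0 Q : vars_in Q 0.
Proof. by apply/wlt_dvars; apply: wlt0. Qed.

Lemma vars_inD Q p q : vars_in Q p -> vars_in Q q -> vars_in Q (p + q).
Proof. by move=> /wlt_dvars pQ /wlt_dvars qQ; apply/wlt_dvars/wltD. Qed.

Lemma vars_inB Q p q : vars_in Q p -> vars_in Q q -> vars_in Q (p - q).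
Proof. by move=> /wlt_dvars pQ /wlt_dvars qQ; apply/wlt_dvars/wltB. Qed.

Lemma vars_inM Q p q : vars_in Q p -> vars_in Q q -> vars_in Q (p * q).
Proof.
by move=> /wlt_dvars pQ /wlt_dvars qQ; apply/wlt_dvars; apply: (@wltM _ _ _ _ 0).
Qed.

Lemma vars_inC Q (a : K) : vars_in Q (dC J a).
Proof. by apply/wlt_dvars; apply: wltC. Qed.

Lemma vars_inE Q p n : vars_in Q p -> vars_in Q (p ^+ n).
Proof.
move=> pQ; elim: n => [|n IHn]; last by rewrite exprS; apply: vars_inM.
by rewrite expr0 -(rmorph1 (@dC m K J)); apply: vars_inC.
Qed.

Lemma vars_inX Q v : Q v -> vars_in Q (dX K v).
Proof. by move=> vQ u; rewrite dvarsX inE => /eqP->. Qed.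

Lemma vars_in_sum Q (I : eqType) (r : seq I) (G : I -> dpoly K J) :
  (forall i, i \in r -> vars_in Q (G i)) -> vars_in Q (\sum_(i <- r) G i).
Proof.
move=> Gn; rewrite big_seq; apply: (big_ind (vars_in Q)) => //.
- exact: vars_in0.
- exact: vars_inD.
Qed.

Lemma vars_inW (Q Q' : pred (dvar m J)) p :
  (forall v, Q v -> Q' v) -> vars_in Q p -> vars_in Q' p.
Proof. by move=> QQ' pQ v /pQ/QQ'. Qed.

Lemma vars_in_factor Q p q : p * q != 0 -> vars_in Q (p * q) -> vars_in Q p.
Proof.
move=> pq0; have p0 : p != 0 by apply: contraNneq pq0 => ->; rewrite mul0r.
have q0 : q != 0 by apply: contraNneq pq0 => ->; rewrite mulr0.
move=> /wlt_dvars/(wlt_wdeg _ _ pq0); rewrite wdegM // => dpq.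
apply/wlt_dvars/(wlt_wdeg _ _ p0); exact: leq_ltn_trans (leq_addr _ _) dpq.
Qed.

Lemma vars_in_der Q Q' i p :
  (forall v, Q v -> Q' v /\ Q' (v.1, v.2 + theta_delta i)) ->
  vars_in Q p -> vars_in Q' (dp_der i p).
Proof.
move=> QQ' pQ; suff [] : vars_in Q' p /\ vars_in Q' (dp_der i p) by [].
apply: (@dp_ind_in _ _ _ (fun q => vars_in Q' q /\ vars_in Q' (dp_der i q))).
- by move=> a; rewrite dp_derC; split; apply: vars_inC.
- move=> v /pQ/QQ'[vQ dvQ]; rewrite dp_derX; split; exact: vars_inX.
- move=> q r [q1 q2] [r1 r2]; rewrite (dp_derD i q r).
  by split; apply: vars_inD.
- move=> q r [q1 q2] [r1 r2]; rewrite (dp_derM i q r).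
  by split; [|apply: vars_inD]; apply: vars_inM.
Qed.

Lemma dC_of_no_vars p : (forall v, v \notin dvars p) -> exists a, p = dC J a.
Proof.
move=> nov; apply: wlt_const => mu mup; rewrite ltnS leqn0 /wt big_seq.
rewrite sum_nat_seq_eq0; apply/allP => v vmu /=; apply/implyP => _.
by case/mem_dvars: (nov v); exists mu.
Qed.

Definition tdeg p := wdeg (fun=> 1%N) p.

Lemma tdeg_not_divides p q : p != 0 -> q != 0 -> (tdeg q < tdeg p)%N ->
  ~ divides p q.
Proof.
move=> p0 q0 dqp [r qE]; move: dqp.
have r0 : r != 0 by apply: contraNneq q0 => r0; rewrite qE r0 mulr0.
by rewrite qE /tdeg wdegM // ltnNge leq_addr.
Qed.

(** The quotient has degree 0. *)
Lemma tdeg_divides_const p q : p != 0 -> divides p q ->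
  wlt (fun=> 1%N) (tdeg p).+1 q -> exists a, q = dC J a * p.
Proof.
move=> p0 [r ->]; have [->|r0] := eqVneq r 0.
  by exists 0; rewrite rmorph0 mulr0 mul0r.
move/(wlt_wdeg _ _ (dp_mulf_neq0 p0 r0)); rewrite wdegM // ltnS.
rewrite -[X in (_ <= X)%N]addn0 leq_add2l leqn0 => /eqP dr0.
have [a ->] : exists a, r = dC J a.
  by apply: wlt_const; apply/(wlt_wdeg _ _ r0); rewrite dr0.
by exists a; rewrite mulrC.
Qed.

(** Polynomials obtained from p by changing the coefficients of its monomials; the
initial and the separant become of this form once multiplied by a power of the
variable. *)
Definition select (c : {cmonom (dvar m J)} -> K) p : dpoly K J :=
  \sum_(nu <- msupp p) dp_mono (c nu) nu.

Lemma mcoeff_select c p mu : mu \in msupp p -> (select c p)@_mu = c mu.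
Proof.
move=> mup; rewrite raddf_sum (big_fsetD1 mu) //= big1_fset => [|nu].
  by rewrite addr0 mcoeff_mono eqxx.
move=> /fsetD1P[numu _] _.
by rewrite mcoeff_mono (negPf numu) mulr0n.
Qed.

Lemma tdeg_select c p :
  p != 0 -> select c p != 0 -> (tdeg (select c p) <= tdeg p)%N.
Proof.
move=> p0 q0; rewrite -ltnS; apply/(wlt_wdeg _ _ q0); apply: wlt_sum => mu mup.
apply: wltW (@wlt_mono _ _ _ _ _ _).
by move: mu mup; apply/(wlt_wdeg _ _ p0).
Qed.

Lemma vars_in_select c p : vars_in (mem (dvars p)) (select c p).
Proof.
apply: vars_in_sum => mu mup v /mem_dvars[nu].
rewrite -mcoeff_neq0 mcoeff_mono; case: (mu =P nu) => [<- _ vmu|_].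
  by apply/mem_dvars; exists mu.
by rewrite mulr0n eqxx.
Qed.

Lemma divcmK (mu : {cmonom (dvar m J)}) v d : (d <= mu v)%N ->
  mulcm (divcm mu (expcmn (ucm v) d)) (expcmn (ucm v) d) = mu :> {cmonom (dvar m J)}.
Proof.
move=> dv; apply/eqP/cmP => u; rewrite mulcmE divcmE expcmnE ucmE.
by case: eqP => [<-|_]; rewrite ?muln1 ?muln0 ?subn0 ?addn0 // subnK.
Qed.

Lemma dX_exp v d : dX K v ^+ d = dp_mono 1 (expcmn (ucm v) d).
Proof. by rewrite dp_mono1X. Qed.

Lemma partial_mulX v p :
  partial v p * dX K v = select (fun mu => p@_mu *+ mu v) p.
Proof.
rewrite /partial mulr_suml; apply: eq_bigr => mu _; rewrite /dX dp_monoM mulr1.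
have [->|mu0] := posnP (mu v); first by rewrite mulr0n !dp_mono0.
by congr dp_mono; apply: (@divcmK mu v 1).
Qed.

Lemma initial_mulX v p : initial v p * dX K v ^+ deg_in v p =
  select (fun mu => if mu v == deg_in v p then p@_mu else 0) p.
Proof.
rewrite /initial mulr_suml big_mkcond; apply: eq_bigr => mu _.
case: eqP => [muv|_]; last by rewrite dp_mono0.
by rewrite dX_exp dp_monoM mulr1 divcmK // muv.
Qed.

Lemma dX_neq0 v : dX K v != 0 :> dpoly K J.
Proof.
apply/eqP => /(congr1 (fun p : dpoly K J => p@_(ucm v))).
by rewrite mcoeff_mono eqxx mcoeff0 => /eqP; rewrite oner_eq0.
Qed.

Lemma tdegX v : tdeg (dX K v) = 1%N.
Proof.
rewrite /tdeg /wdeg /dX grade_mono wtU mul_polyC -mul_polyC.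
by rewrite size_proper_mul ?lead_coefXn ?lead_coefC ?mulr1 ?size_polyC
   ?size_polyXn ?dX_neq0.
Qed.

Section Leader.
Variables (p : dpoly K J) (v : dvar m J).
Hypothesis vp : v \in dvars p.

Let p0 : p != 0.
Proof. by apply/eqP => p0; case/mem_dvars: vp => mu; rewrite p0 msupp0 inE. Qed.

(** The product of the separant by v is p with each coefficient multiplied by the
exponent of v. It is nonzero in characteristic 0 and its degree is at most that
of p, hence the separant has a smaller degree than p. *)
Lemma partial_facts :
  [/\ partial v p != 0, ~ divides p (partial v p)
    & vars_in (mem (dvars p)) (partial v p)].
Proof.
case/mem_dvars: vp => mu mup vmu.
have q0 : partial v p * dX K v != 0.
  apply/eqP => /(congr1 (fun q : dpoly K J => q@_mu)).
  rewrite partial_mulX mcoeff_select // mcoeff0 => /eqP.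
  rewrite -mulr_natr mulf_eq0 mcoeff_eq0 mup /=.
  by rewrite ((pcharf0P K).1 (@df_char0 m K)) cmE_eq0 vmu.
have S0 : partial v p != 0 by apply: contraNneq q0 => ->; rewrite mul0r.
split=> //; last first.
  by apply: vars_in_factor q0 _; rewrite partial_mulX; apply: vars_in_select.
apply: tdeg_not_divides => //.
have: (tdeg (partial v p * dX K v)%R <= tdeg p)%N.
  by move: q0; rewrite partial_mulX; apply: tdeg_select.
by rewrite {1}/tdeg wdegM ?dX_neq0 // [X in (_ + X)%N]tdegX addn1.
Qed.

End Leader.
End DvarsIn.

(** * Rankings *)

Lemma total_max (T : eqType) (r : rel T) (s : seq T) :
  total r -> transitive r -> s != [::] ->
  exists2 x, x \in s & forall y, y \in s -> r y x.
Proof.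
move=> tot tr; elim: s => // x s IHs _.
have rxx z : r z z by have := tot z z; rewrite orbb.
have [->|/IHs[z zs zmax]] := eqVneq s [::].
  by exists x => [|y]; rewrite inE // => /eqP->.
have [rxz|/negPf rxz] := boolP (r x z).
  by exists z => [|y]; rewrite inE ?zs ?orbT // => /predU1P[->|/zmax].
exists x => [|y]; rewrite inE ?eqxx // => /predU1P[->//|/zmax ryz].
by apply: tr ryz _; have := tot x z; rewrite rxz.
Qed.

Section Initial.
Variables (m : nat) (K : deltaField m) (J : choiceType).
Variables (p : dpoly K J) (v : dvar m J).
Hypothesis vp : v \in dvars p.

Lemma initial_facts :
  [/\ initial v p != 0, ~ divides p (initial v p)
    & vars_in (mem (dvars p)) (initial v p)].
Proof.
case/mem_dvars: vp => mu0 mup0 vmu0.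
have p0 : p != 0 by apply/eqP => p0; rewrite p0 msupp0 inE in mup0.
have d0 : (0 < deg_in v p)%N.
  rewrite /deg_in (big_fsetD1 mu0) //=; apply: leq_trans (leq_maxl _ _).
  by rewrite lt0n cmE_neq0.
have sne : enum_fset (msupp p) != [::].
  apply/eqP => s0; have: mu0 \in enum_fset (msupp p) by [].
  by rewrite s0.
have [mu mup mumax] := @total_max _ (fun mu nu : {cmonom (dvar m J)} => (mu v <= nu v)%N)
  (msupp p) (fun a b => leq_total _ _) (fun b a c => @leq_trans _ _ _) sne.
have muE : mu v = deg_in v p.
  apply/eqP; rewrite eqn_leq; apply/andP; split.
    by rewrite /deg_in (big_fsetD1 mu) //=; apply: leq_maxl.
  by apply/bigmax_leqP_seq => nu nup _; apply: mumax.
have q0 : initial v p * dX K v ^+ deg_in v p != 0.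
  apply/eqP => /(congr1 (fun q : dpoly K J => q@_mu)).
  rewrite initial_mulX mcoeff_select // mcoeff0 muE eqxx => /eqP.
  by rewrite (mcoeff_eq0 p) mup.
have I0 : initial v p != 0 by apply: contraNneq q0 => ->; rewrite mul0r.
have X0 : dX K v ^+ deg_in v p != 0 by apply: contraNneq q0 => ->; rewrite mulr0.
split=> //; last first.
  by apply: vars_in_factor q0 _; rewrite initial_mulX; apply: vars_in_select.
apply: tdeg_not_divides => //.
have: (tdeg (initial v p * dX K v ^+ deg_in v p)%R <= tdeg p)%N.
  by move: q0; rewrite initial_mulX; apply: tdeg_select.
rewrite {1}/tdeg wdegM //; apply: leq_trans.
rewrite -[X in (X < _)%N]addn0 ltn_add2l.
case: (deg_in v p) d0 X0 => // d _ X0; rewrite exprS in X0 *.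
have Xd0 : dX K v ^+ d != 0 by apply: contraNneq X0 => ->; rewrite mulr0.
by rewrite wdegM ?dX_neq0 // [X in (X + _)%N]tdegX.
Qed.

End Initial.

Section Ranking.
Variables (m : nat) (J : choiceType) (rk : rel (dvar m J)).
Hypothesis hrk : ranking rk.
Implicit Types (v u w : dvar m J) (e : Theta m).

Definition shift v e : dvar m J := (v.1, v.2 + e).

Definition rk_lt v : pred (dvar m J) := fun u => rk u v && (u != v).

Lemma rk_refl v : rk v v.
Proof. by case: hrk => tot _ _ _ _; have := tot v v; rewrite orbb. Qed.

Lemma rk_trans : transitive rk. Proof. by case: hrk. Qed.

Lemma rk_anti : antisymmetric rk. Proof. by case: hrk. Qed.

Lemma thetaI e : injective (fun e' : Theta m => e' + e).
Proof.
move=> e1 e2 /ffunP ee; apply/ffunP => i; have := ee i.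
by rewrite !thetaDE => /addIn.
Qed.

Lemma shift0 v : shift v 0 = v. Proof. by rewrite /shift addr0; case: v. Qed.

Lemma shiftD v e e' : shift v (e + e') = shift (shift v e) e'.
Proof. by rewrite /shift addrA. Qed.

Lemma shift_inj v : injective (shift v).
Proof. by move=> e e' [] ; rewrite ![v.2 + _]addrC => /thetaI. Qed.

Lemma rk_shiftr v e : rk v (shift v e).
Proof. by case: hrk => _ _ _ H _; rewrite /shift addrC; case: v => j e'; apply: H. Qed.

Lemma rk_shift u v e : rk u v -> rk (shift u e) (shift v e).
Proof.
case: hrk => _ _ _ _ H; rewrite /shift ![_ + e]addrC.
by case: u v => [j a] [k b]; apply: H.
Qed.

Lemma rk_lt_le u v w : rk u v -> rk_lt w v -> rk_lt w u.
Proof.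
move=> uv /andP[vw vNw]; rewrite /rk_lt (rk_trans uv vw) /=.
by apply: contraNneq vNw => uw; apply/eqP/rk_anti; rewrite vw -uw.
Qed.

Lemma rk_lt_shift u v e : rk_lt v u -> rk_lt (shift v e) (shift u e).
Proof.
case/andP=> uv uNv; rewrite /rk_lt rk_shift //=.
apply: contraNneq uNv; case: u v uv => [j a] [k b] _ [-> /thetaI->//].
Qed.

Lemma rk_lt_shiftr v e : e != 0 -> rk_lt (shift v e) v.
Proof.
move=> e0; rewrite /rk_lt rk_shiftr /=; apply: contraNneq e0 => ve.
by apply/eqP/(@shift_inj v); rewrite shift0.
Qed.

Lemma rk_ltW u v : rk_lt v u -> rk u v. Proof. by case/andP. Qed.

End Ranking.

(** * Elimination of one variable *)

Section Elimination.
Variables (m : nat) (K : deltaField m) (J : choiceType).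
Variables (x : dvar m J) (S T : dpoly K J).
Hypotheses (S0 : S != 0) (Sx : vars_in (predC1 x) S) (Tx : vars_in (predC1 x) T).

(** Modulo S x + T, the product S x is congruent to -T, which is free of x; a large
power of S therefore removes x from any polynomial. *)
Lemma elimination a : exists N b c,
  S ^+ N * a = b + (S * dX K x + T) * c /\ vars_in (predC1 x) b.
Proof.
have SNx N : vars_in (predC1 x) (S ^+ N) by exact: vars_inE.
elim/dp_ind: a => [a|v|p q [N [b [c [E bx]]]] [N' [b' [c' [E' b'x]]]]
                      |p q [N [b [c [E bx]]]] [N' [b' [c' [E' b'x]]]]].
- exists 0%N, (dC J a), 0; rewrite expr0 mul1r mulr0 addr0; split=> //.
  exact: vars_inC.
- have [->|vx] := eqVneq v x.
    exists 1%N, (0 - T), 1; rewrite expr1 mulr1; split.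
      by rewrite sub0r addrCA addNr addr0.
    by apply: vars_inB => //; apply: vars_in0.
  exists 0%N, (dX K v), 0; rewrite expr0 mul1r mulr0 addr0; split=> //.
  exact: vars_inX.
- exists (N + N')%N, (S ^+ N' * b + S ^+ N * b'), (S ^+ N' * c + S ^+ N * c').
  split; last by apply: vars_inD; apply: vars_inM.
  have Ep : S ^+ N * S ^+ N' * p = S ^+ N' * b + (S * dX K x + T) * (S ^+ N' * c).
    by rewrite mulrAC E mulrC mulrDr (mulrCA (S ^+ N')).
  have Eq : S ^+ N * S ^+ N' * q = S ^+ N * b' + (S * dX K x + T) * (S ^+ N * c').
    by rewrite -mulrA E' mulrDr (mulrCA (S ^+ N)).
  by rewrite exprD mulrDr Ep Eq addrACA -mulrDr.
- exists (N + N')%N, (b * b'), (c * (S ^+ N' * q) + b * c').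
  split; last exact: vars_inM.
  rewrite exprD mulrACA E mulrDl {1}E' mulrDr -addrA; congr (_ + _).
  by rewrite addrC [RHS]mulrDr [X in _ = X + _]mulrA (mulrCA b).
Qed.

Lemma elimination_family (I : eqType) (s : seq I) (a : I -> dpoly K J) :
  exists N b c, forall i, i \in s ->
    S ^+ N * a i = b i + (S * dX K x + T) * c i /\ vars_in (predC1 x) (b i).
Proof.
have SNx N : vars_in (predC1 x) (S ^+ N) by exact: vars_inE.
elim: s => [|i0 s [N [b [c IHs]]]]; first by exists 0%N, a, a.
have [N0 [b0 [c0 [E0 b0x]]]] := elimination (a i0).
exists (N0 + N)%N.
exists (fun i => if i == i0 then S ^+ N * b0 else S ^+ N0 * b i).
exists (fun i => if i == i0 then S ^+ N * c0 else S ^+ N0 * c i).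
move=> i; rewrite inE exprD; case: eqP => [-> _|_ /= /IHs[E bx]].
  split; last exact: vars_inM.
  by rewrite mulrAC E0 mulrC mulrDr (mulrCA (S ^+ N)).
split; last exact: vars_inM.
by rewrite -mulrA E mulrDr (mulrCA (S ^+ N0)).
Qed.

(** Since S is nonzero and free of x, the polynomial S x + T has degree 1 in x, and
its nonzero multiples involve x. *)
Lemma elimination_unique c : vars_in (predC1 x) ((S * dX K x + T) * c) -> c = 0.
Proof.
move=> cx; apply/eqP; apply: contraT => c0.
pose w := fun u : dvar m J => ~~ predC1 x u : nat.
have SX0 : S * dX K x != 0 by rewrite dp_mulf_neq0 // dX_neq0.
have wSX : (0 < wdeg w (S * dX K x)%R)%N.
  rewrite ltnNge leqn0; apply/negP => /eqP d0.
  have: vars_in (predC1 x) (dX K x * S).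
    by apply/wlt_dvars; rewrite mulrC; apply/(wlt_wdeg _ _ SX0); rewrite -/w d0.
  move/vars_in_factor; rewrite mulrC => /(_ SX0 x).
  by rewrite dvarsX inE eqxx => /(_ isT); rewrite /= eqxx.
have L0 : S * dX K x + T != 0.
  apply/eqP => L0; move: wSX; rewrite lt0n => /negP[]; rewrite -leqn0 -ltnS.
  apply/(wlt_wdeg _ _ SX0)/wlt_dvars.
  have -> : S * dX K x = (S * dX K x + T) - T by rewrite addrK.
  by rewrite L0; apply: vars_inB => //; apply: vars_in0.
have Lx : vars_in (predC1 x) (S * dX K x + T).
  by apply: vars_in_factor cx; apply: dp_mulf_neq0.
have SXx : vars_in (predC1 x) (S * dX K x).
  have -> : S * dX K x = (S * dX K x + T) - T by rewrite addrK.
  exact: vars_inB.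
by move: SXx => /wlt_dvars/(wlt_wdeg _ _ SX0); rewrite ltnS leqNgt wSX.
Qed.

End Elimination.

(** * Low elements of the ideal of a single polynomial *)

Section Rosenfeld.
Variables (m : nat) (K : deltaField m) (J : choiceType) (rk : rel (dvar m J)).
Hypothesis hrk : ranking rk.
Variables (f : dpoly K J) (v : dvar m J).
Hypothesis hv : leader rk v f.
Implicit Types (e : Theta m) (h : dpoly K J).

Let S := separant v f.
Let thetaf e : dpoly K J := theta_app (@dp_der m K J) e f.
Let le_v : pred (dvar m J) := fun u => rk u v.

Let vf : v \in dvars f. Proof. by case: hv. Qed.

Let S0 : S != 0. Proof. by case: (partial_facts vf). Qed.

Let f_le : vars_in le_v f. Proof. by case: hv. Qed.

Let S_le : vars_in le_v S.
Proof.
by have [_ _] := partial_facts vf; apply: vars_inW => u; case: hv => _; apply.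
Qed.

Let thetafS e i : thetaf (e + theta_delta i) = dp_der i (thetaf e).
Proof. apply: theta_appS; exact: dp_der_comm. Qed.

Let delta_neq0 (i : 'I_m) : theta_delta i != 0.
Proof.
by apply/eqP => /(congr1 (@theta_ord m)); rewrite theta_ord_delta theta_ord0.
Qed.

Let le_lt_shift e u : e != 0 -> rk u v -> rk_lt rk (shift v e) u.
Proof. by move=> e0 uv; apply: (rk_lt_le hrk uv); apply: rk_lt_shiftr. Qed.

(** By the chain rule the derivative of p is the sum over u of dp/du times the
derivative of u; the term u = v is the leading one, and every derivative of a
lower u is lower than that of v. *)
Lemma der_leading i p : vars_in le_v p ->
  vars_in (rk_lt rk (shift v (theta_delta i)))
    (dp_der i p - partial v p * dX K (shift v (theta_delta i))).
Proof.
set x := shift v _; set Q := rk_lt rk x => ple.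
have leQ u : rk u v -> Q u by apply: le_lt_shift.
have W q : vars_in le_v q -> vars_in Q q by exact: vars_inW.
suff [] : vars_in le_v p /\ vars_in Q (dp_der i p - partial v p * dX K x) by [].
apply: (@dp_ind_in _ _ _
  (fun q => vars_in le_v q /\ vars_in Q (dp_der i q - partial v q * dX K x))).
- move=> a; rewrite dp_derC partialC mul0r subr0; split; exact: vars_inC.
- move=> u /ple uv; split; first exact: vars_inX.
  rewrite dp_derX partialX; case: eqP => [<-|/eqP vu].
    by rewrite mul1r subrr; apply: vars_in0.
  rewrite mul0r subr0; apply: vars_inX.
  by apply: (rk_lt_shift hrk); apply/andP; split; rewrite // eq_sym.
- move=> q r [qle qQ] [rle rQ]; split; first exact: vars_inD.
  rewrite (dp_derD i q r) (partialD v q r) mulrDl opprD addrACA.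
  exact: vars_inD.
- move=> q r [qle qQ] [rle rQ]; split; first exact: vars_inM.
  rewrite (dp_derM i q r) (partialM v q r) (mulrDl (partial v q * r)) opprD addrACA.
  apply: vars_inD; first by rewrite mulrAC -mulrBl; apply: vars_inM => //; apply: W.
  by rewrite -mulrA -mulrBr; apply: vars_inM => //; apply: W.
Qed.

(** Proper derivatives of f have degree 1 in their leader, with the separant of f as
initial. *)
Lemma theta_leading e : e != 0 -> exists T,
  thetaf e = S * dX K (shift v e) + T /\ vars_in (rk_lt rk (shift v e)) T.
Proof.
elim/theta_ind: e => [|e i IHe _]; first by rewrite eqxx.
have [->|e0] := eqVneq e 0.
  rewrite add0r; exists (dp_der i f - S * dX K (shift v (theta_delta i))).
  split; last exact: der_leading.
  by rewrite -[theta_delta i]add0r thetafS /thetaf theta_app0 addrC subrK.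
have {IHe} [T [E TQ]] := IHe e0.
set w := shift v e in E TQ.
have -> : shift v (e + theta_delta i) = shift w (theta_delta i) by exact: shiftD.
exists (dp_der i S * dX K w + dp_der i T); split.
  rewrite thetafS E (dp_derD i (S * dX K w)) (dp_derM i S) dp_derX.
  by rewrite -addrA addrCA.
have lt_w : rk_lt rk w v by apply: rk_lt_shiftr.
have lt_dw : rk_lt rk (shift w (theta_delta i)) w by apply: rk_lt_shiftr.
have lt_trans u : rk_lt rk w u -> rk_lt rk (shift w (theta_delta i)) u.
  by move=> /rk_ltW uw; apply: (rk_lt_le hrk uw).
apply: vars_inD.
  apply: vars_inM; last exact: vars_inX.
  apply: (@vars_in_der _ _ _ le_v) => // u uv; split.
    exact: (rk_lt_le hrk (rk_trans hrk uv (rk_ltW lt_w))).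
  exact: (rk_lt_le hrk (rk_shift hrk _ uv)) (rk_lt_shift hrk _ lt_w).
apply: vars_in_der TQ => u uw; split; first exact: lt_trans.
exact: rk_lt_shift.
Qed.

Lemma theta_vars e : vars_in (fun u => rk u (shift v e)) (thetaf e).
Proof.
have [->|e0] := eqVneq e 0; first by rewrite shift0 /thetaf theta_app0.
have [T [-> TQ]] := theta_leading e0; apply: vars_inD.
  apply: vars_inM; last by apply: vars_inX; apply: rk_refl.
  by apply: vars_inW S_le => u uv; apply: rk_trans uv (rk_shiftr hrk _ _).
by apply: vars_inW TQ => u /rk_ltW.
Qed.

Let comb (D : {fset Theta m}) h :=
  exists a : Theta m -> dpoly K J, h = \sum_(e <- D) a e * thetaf e.

Let comb_sub (D D' : {fset Theta m}) h : (D `<=` D')%fset -> comb D h -> comb D' h.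
Proof.
move=> sD [a ->]; exists (fun e => if e \in D then a e else 0).
rewrite -(big_fset_incl _ sD) => [|e _ /negPf->]; last by rewrite mul0r.
by rewrite big_seq [RHS]big_seq; apply: eq_bigr => e ->.
Qed.

(** The combinations of derivatives of f with polynomial coefficients are stable
under the derivations. *)
Lemma delta_gen_comb h : delta_gen (fun g => g = f) h -> exists D, comb D h.
Proof.
have combD h1 h2 : (exists D, comb D h1) -> (exists D, comb D h2) ->
    exists D, comb D (h1 + h2).
  move=> [D1 c1] [D2 c2]; exists (D1 `|` D2)%fset.
  have [a1 ->] := comb_sub (fsubsetUl _ _ : (D1 `<=` D1 `|` D2)%fset) c1.
  have [a2 ->] := comb_sub (fsubsetUr _ _ : (D2 `<=` D1 `|` D2)%fset) c2.
  exists (fun e => a1 e + a2 e); rewrite -big_split /=.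
  by apply: eq_bigr => e _; rewrite mulrDl.
have comb1 a e : exists D, comb D (a * thetaf e).
  by exists [fset e]%fset, (fun=> a); rewrite big_seq_fset1.
have comb0 : exists D, comb D 0.
  by exists fset0, (fun=> 0); rewrite big_seq_fset0.
move=> /(_ (fun g => exists D, comb D g)); apply; last first.
  by move=> _ ->; have := comb1 1 0; rewrite mul1r /thetaf theta_app0.
split; first split=> //.
  move=> a _ _ [D [b ->]]; exists D, (fun e => a * b e).
  by rewrite mulr_sumr; apply: eq_bigr => e _; rewrite mulrA.
move=> i _ [D [b ->]].
apply: (big_ind (fun g => exists D, comb D (dp_der i g))).
- by rewrite dp_der0.
- by move=> g1 g2 c1 c2; rewrite (dp_derD i g1 g2); apply: combD.
- by move=> e _; rewrite (dp_derM i (b e)) -thetafS; apply: combD.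
Qed.

(** Induction on the number of derivatives of f in the combination. For the one with
the highest leader x, every coefficient is made free of x modulo S x + T, up to a
power of S. As nothing else involves x, the multiple of S x + T that remains must
vanish, and the combination got shorter. *)
Lemma rosenfeld_comb (D : {fset Theta m}) h : comb D h -> vars_in le_v h ->
  exists N, divides f (S ^+ N * h).
Proof.
elim: {D}#|`D| {-2}D (leqnn #|`D|) h => [|k IHk] D sD h [a hE] hle.
  move: sD; rewrite leqn0 cardfs_eq0 => /eqP D0.
  by exists 0%N, 0; rewrite hE D0 big_seq_fset0 !mulr0.
have [D0|Dn0] := eqVneq (enum_fset D) [::].
  by exists 0%N, 0; rewrite hE D0 big_nil !mulr0.
pose r := relpre (shift v) rk.
have rtot : total r by move=> e e'; case: hrk => tot _ _ _ _; apply: tot.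
have rtr : transitive r by move=> e e' e'' ; apply: rk_trans.
have [e eD emax] := total_max rtot rtr Dn0.
have [e0|e0] := eqVneq e 0.
  (* Since rk v (shift v e') always holds, this means that only f itself occurs. *)
  exists 0%N, (a 0); rewrite expr0 mul1r hE (big_fsetD1 e) //= big1_fset.
    by rewrite addr0 e0 /thetaf theta_app0 mulrC.
  move=> e' /fsetD1P[e'e /emax e'max] _; case/eqP: e'e; apply: (@shift_inj _ _ v).
  apply: (rk_anti hrk); rewrite [rk _ _]e'max e0 shift0.
  exact: rk_shiftr.
have [T [eE TQ]] := theta_leading e0; set x := shift v e in eE TQ.
have le_neq u : rk u v -> u != x by move/(le_lt_shift e0)/andP => -[].
have Sx : vars_in (predC1 x) S by apply: vars_inW S_le.
have Tx : vars_in (predC1 x) T by apply: vars_inW TQ => u /andP[].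
have thx e' : e' \in (D `\ e)%fset -> vars_in (predC1 x) (thetaf e').
  move=> /fsetD1P[e'e /emax e'max]; apply: vars_inW (theta_vars (e := e')) => u ue'.
  apply: contraNneq e'e => ux; apply/eqP/(@shift_inj _ _ v)/(rk_anti hrk).
  by rewrite [rk (shift v e') _]e'max -/x -ux.
(* The coefficient a e is left alone: it multiplies S x + T. *)
have [N [b [c bcE]]] := elimination_family Sx Tx (D `\ e)%fset a.
pose h' := \sum_(e' <- (D `\ e)%fset) b e' * thetaf e'.
pose d := S ^+ N * a e + \sum_(e' <- (D `\ e)%fset) c e' * thetaf e'.
have h'E : S ^+ N * h = h' + (S * dX K x + T) * d.
  have sumE : S ^+ N * (\sum_(e' <- (D `\ e)%fset) a e' * thetaf e') =
      h' + (S * dX K x + T) * (\sum_(e' <- (D `\ e)%fset) c e' * thetaf e').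
    rewrite !mulr_sumr -big_split /= !big_seq; apply: eq_bigr => e' /bcE[E _].
    by rewrite !mulrA E mulrDl.
  rewrite hE (big_fsetD1 e) //= (mulrDr (S ^+ N)) sumE eE /d.
  have -> : S ^+ N * (a e * (S * dX K x + T)) = (S * dX K x + T) * (S ^+ N * a e).
    by rewrite mulrA mulrC.
  rewrite [X in _ = _ + X]mulrDr; exact: addrCA.
have h'x : vars_in (predC1 x) h'.
  apply: vars_in_sum => e' e'D; apply: vars_inM; last exact: thx.
  by case: (bcE e' e'D).
have hSx : vars_in (predC1 x) (S ^+ N * h).
  by apply: vars_inM; [apply: vars_inE | apply: vars_inW hle].
have d0 : d = 0.
  apply: (elimination_unique S0 Tx).
  have -> : (S * dX K x + T) * d = S ^+ N * h - h' by rewrite h'E addrAC subrr add0r.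
  exact: vars_inB.
have sDe : (#|` (D `\ e)%fset| <= k)%N by move: sD; rewrite (cardfsD1 e) eD.
have cDe : comb (D `\ e)%fset (S ^+ N * h) by exists b; rewrite h'E d0 mulr0 addr0.
have le_Sh : vars_in le_v (S ^+ N * h) by apply: vars_inM => //; apply: vars_inE.
have [N' [q qE]] := IHk _ sDe _ cDe le_Sh.
by exists (N' + N)%N, q; rewrite exprD -mulrA.
Qed.

Theorem rosenfeld h : delta_gen (fun g => g = f) h -> vars_in le_v h ->
  exists N, divides f (S ^+ N * h).
Proof. by case/delta_gen_comb=> D; apply: rosenfeld_comb. Qed.

End Rosenfeld.

Section Saturation.
Variables (m : nat) (K : deltaField m) (J : choiceType).
Variables (f : dpoly K J).
Hypothesis firr : irreducible f.

Lemma irreducible_dvd_exp p N : ~ divides f p -> ~ divides f (p ^+ N).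
Proof.
move=> fp; elim: N => [|N IHN].
  by case=> g fg; case: firr => _ fU _; apply: fU; exists g.
by rewrite exprS => /(dp_irreducible_prime firr)[].
Qed.

(** If (I1 S1)^k q is in [f], where I1 and S1 are the initial and the separant for
rk1, it is also low for rk2: the variables of I1 and S1 are among those of f. So
f divides S^N (I1 S1)^k q, and it divides q since it is prime and divides neither
of S, I1 and S1. *)
Theorem sat_low_divides (rk1 rk2 : rel (dvar m J)) (v : dvar m J) q :
  ranking rk2 -> leader rk2 v f -> sat rk1 f q ->
  vars_in (fun u => rk2 u v) q -> divides f q.
Proof.
move=> hrk2 hv [v1 [v1f _] [k kq]] qv; have [vf fv] := hv.
have [I0 fI Ivars] := initial_facts v1f; have [S10 fS1 S1vars] := partial_facts v1f.
have [S0 fS _] := partial_facts vf.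
have ISv : vars_in (fun u => rk2 u v) ((initial v1 f * separant v1 f) ^+ k * q).
  by apply: vars_inM => //; apply: vars_inE; apply: vars_inM;
    [apply: vars_inW Ivars | apply: vars_inW S1vars].
have [N] := rosenfeld hrk2 hv kq ISv.
case/(dp_irreducible_prime firr) => [/irreducible_dvd_exp []//|].
case/(dp_irreducible_prime firr) => // /irreducible_dvd_exp [] //.
by case/(dp_irreducible_prime firr).
Qed.

End Saturation.

(** * Coefficients with respect to lambda *)

Section MalgMap.
Variables (V : choiceType) (R S A : comNzRingType).

Fact mon_val_is_mmorphism (x : V -> A) : mmorphism (@mon_val V A x).
Proof. by split; [exact: mon_valM | exact: mon_val1]. Qed.

HB.instance Definition _ (x : V -> A) :=
  monalg.isMultiplicative.Build {cmonom V} A (@mon_val V A x)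
    (mon_val_is_mmorphism x).

Definition malg_mon (mu : {cmonom V}) : {malg S[{cmonom V}]} := << mu >>.

Fact malgU_is_mmorphism : mmorphism malg_mon.
Proof. by split=> [mu nu|//]; rewrite [RHS]fgmulUU mulr1. Qed.

HB.instance Definition _ :=
  monalg.isMultiplicative.Build {cmonom V} {malg S[{cmonom V}]} malg_mon
    malgU_is_mmorphism.

Variable g : {rmorphism R -> S}.

Definition malg_map : {rmorphism {malg R[{cmonom V}]} -> {malg S[{cmonom V}]}} :=
  mmap (@malgC {cmonom V} S \o g) malg_mon.

Lemma mcoeff_malg_map a nu : (malg_map a)@_nu = g a@_nu.
Proof.
rewrite /malg_map /= /mmap raddf_sum /=.
under eq_bigr => mu _ do rewrite mcoeffCM mcoeffU1.
case: (msuppP a nu) => [nua|]; last rewrite rmorph0.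
  rewrite (big_fsetD1 nu) //= eqxx mulr1 big1_fset ?addr0 // => mu.
  by move=> /fsetD1P[/negPf-> _] _; rewrite mulr0.
move=> nua; rewrite big1_fset // => mu mua _.
by case: eqP => [e|_]; rewrite ?mulr0 //; rewrite -e mua in nua.
Qed.

End MalgMap.

Section LambdaCoef.
Variables (m : nat) (K : deltaField m) (J : choiceType).
Implicit Types (p q : dpoly K (option J)) (g : dpoly K J) (nu : {cmonom (Theta m)}).

Definition lam_ring := {malg (dpoly K J)[{cmonom (Theta m)}]}.

(** Differential polynomials in lambda and y are viewed as polynomials in the
derivatives of lambda with coefficients in the differential polynomials in y.
The indeterminate lambda is None. *)
Definition lam_hom : {rmorphism dpoly K (option J) -> lam_ring} :=
  dp_hom (@malgC {cmonom (Theta m)} (dpoly K J) \o @dC m K J)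
    (fun v : dvar m (option J) =>
       if v.1 is Some j then malgC (dX K (j, v.2)) : lam_ring
       else malg_mon _ (ucm v.2)).

Definition lcoef nu p : dpoly K J := (lam_hom p)@_nu.

Lemma lam_homC (a : K) : lam_hom (dC (option J) a) = malgC (dC J a).
Proof. exact: dp_homC. Qed.

Lemma lam_homS (v : dvar m J) : lam_hom (dX K (Some v.1, v.2)) = malgC (dX K v).
Proof. by case: v => j e; exact: dp_homX. Qed.

Lemma lam_homN e : lam_hom (dX K (None, e)) = malg_mon (dpoly K J) (ucm e).
Proof. exact: dp_homX. Qed.

Lemma lam_hom_rename g : lam_hom (dp_rename Some g) = malgC g.
Proof.
pose h : {rmorphism dpoly K J -> lam_ring} := lam_hom \o dp_rename Some.
pose h' : {rmorphism dpoly K J -> lam_ring} := @malgC {cmonom (Theta m)} (dpoly K J).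
apply: (@dp_morph_eq _ _ _ _ h h') => [a|v].
  by rewrite /h /= dp_renameC lam_homC.
by rewrite /h /= dp_renameX lam_homS.
Qed.

Lemma lcoef0 nu : lcoef nu 0 = 0.
Proof. by rewrite /lcoef rmorph0 mcoeff0. Qed.

Lemma lcoefD nu p q : lcoef nu (p + q) = lcoef nu p + lcoef nu q.
Proof. by rewrite /lcoef rmorphD mcoeffD. Qed.

Lemma lcoef_renameM nu g p : lcoef nu (dp_rename Some g * p) = g * lcoef nu p.
Proof. by rewrite /lcoef rmorphM lam_hom_rename mcoeffCM. Qed.

Lemma lcoef_dCM nu (a : K) p :
  lcoef nu (dC (option J) a * p) = dC J a * lcoef nu p.
Proof. by rewrite -(dp_renameC Some a) lcoef_renameM. Qed.

Lemma lcoef_sum nu (T : Type) (r : seq T) (G : T -> dpoly K (option J)) :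
  lcoef nu (\sum_(t <- r) G t) = \sum_(t <- r) lcoef nu (G t).
Proof. exact: (big_morph (lcoef nu) (lcoefD nu) (lcoef0 nu)). Qed.

Lemma lcoef_lambda_exp nu r :
  lcoef nu (dY K None ^+ r) = (expcmn (ucm 0) r == nu)%:R.
Proof.
rewrite /lcoef rmorphXn lam_homN.
suff -> : malg_mon (dpoly K J) (ucm 0) ^+ r =
    malg_mon (dpoly K J) (expcmn (ucm (0 : Theta m)) r).
  exact: mcoeffU1.
elim: r => [|r IHr]; first by rewrite expr0 (mmorph1 (malg_mon (dpoly K J))).
by rewrite exprS IHr expcmnS (mmorphM (malg_mon (dpoly K J))).
Qed.

(** The inverse of [lam_hom]; it shows that the coefficients determine p. *)
Definition lam_unhom : {rmorphism lam_ring -> dpoly K (option J)} :=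
  mmap (dp_rename Some : dpoly K J -> dpoly K (option J))
    (mon_val (fun e : Theta m => dX K (None, e) : dpoly K (option J))).

Lemma lam_homK p : lam_unhom (lam_hom p) = p.
Proof.
apply: (@dp_morph_eq _ _ _ _ (lam_unhom \o lam_hom) idfun) => [a|[[j|] e]] /=.
- by rewrite lam_homC /lam_unhom /= mmapC; exact: dp_renameC.
- by rewrite (lam_homS (j, e)) /lam_unhom /= mmapC; exact: dp_renameX.
- rewrite lam_homN /lam_unhom /= mmapU mon_valU -[RHS]mul1r.
  by congr (_ * _); apply: (rmorph1 (dp_rename Some)).
Qed.

Lemma lcoef_inj p q : (forall nu, lcoef nu p = lcoef nu q) -> p = q.
Proof.
move=> pq; have lam_eq : lam_hom p = lam_hom q by apply/malgP => nu; apply: pq.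
apply: etrans (esym (lam_homK p)) (etrans _ (lam_homK q)).
by rewrite lam_eq.
Qed.

Lemma wlt_lcoef (w : dvar m (option J) -> nat) n nu p :
  wlt w n p -> wlt (fun v => w (Some v.1, v.2)) n (lcoef nu p).
Proof.
set w' := fun v : dvar m J => w (Some v.1, v.2).
(* The filtration argument handles positive bounds; below, p must be 0. *)
case: n => [|n].
  move=> p0; suff -> : p = 0 by rewrite lcoef0; apply: wlt0.
  by apply/eqP; rewrite -(grade_eq0 w) -size_poly_eq0 -leqn0; apply/wltP.
pose L k (a : lam_ring) := forall nu, wlt w' k.+1 a@_nu.
move=> pn; suff : L n (lam_hom p) by apply.
have LU k g nu' : wlt w' k.+1 g -> L k << g *g nu' >>.
  move=> gk nu''; rewrite mcoeffU; case: eqP => _; rewrite ?mulr1n // mulr0n.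
  exact: wlt0.
apply: (@filtration_hom _ _ _ _ L) pn.
- by move=> i j a ij La nu'; apply: wltW (La nu').
- by move=> i nu'; rewrite mcoeff0; apply: wlt0.
- by move=> i a b La Lb nu'; rewrite mcoeffD; apply: wltD.
- by apply: LU; apply: wlt1.
- move=> i j a b La Lb nu'; rewrite mcoeffMl.
  apply: wlt_sum => k1 _; apply: wlt_sum => k2 _.
  case: eqP => _; rewrite ?mulr0n ?mulr1n; last exact: wlt0.
  by rewrite -addnS; apply: wltM.
- by move=> a; apply: LU; apply: wltC.
- move=> [[j|] e] _; first by apply: LU; apply: wltX.
  by apply: LU; apply: (@wltW _ _ _ _ 1) => //; apply: wlt1.
Qed.

End LambdaCoef.

Section LambdaRename.
Variables (m : nat) (K : deltaField m) (J J' : choiceType) (r : J -> J').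

Lemma lcoef_rename nu (p : dpoly K (option J)) :
  lcoef nu (dp_rename (omap r) p) = dp_rename r (lcoef nu p).
Proof.
rewrite /lcoef -(mcoeff_malg_map (dp_rename r)).
pose h : {rmorphism dpoly K (option J) -> lam_ring K J'} :=
  @lam_hom m K J' \o dp_rename (omap r).
pose h' : {rmorphism dpoly K (option J) -> lam_ring K J'} :=
  malg_map _ (dp_rename r) \o @lam_hom m K J.
congr (_ @_ nu); apply: (@dp_morph_eq _ _ _ _ h h') => [a|[[j|] e]].
- by rewrite /h /h' /= dp_renameC !lam_homC /malg_map /= mmapC /= dp_renameC.
- rewrite /h /h' /= dp_renameX (lam_homS K (j, e)) /malg_map /= mmapC /=.
  by rewrite dp_renameX -(lam_homS K (r j, e)).
- by rewrite /h /h' /= dp_renameX !lam_homN /malg_map /= mmapU /= !rmorph1 mul1r.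
Qed.

End LambdaRename.

(** * Differential ideals under substitution *)

Section SubstFacts.
Variables (m : nat) (K : deltaField m) (J J' : choiceType).

Lemma dp_subst_theta (x : J -> dpoly K J') e p :
  dp_subst x (theta_app (@dp_der m K J) e p) =
  theta_app (@dp_der m K J') e (dp_subst x p).
Proof.
elim/theta_ind: e => [|e i IHe]; first by rewrite !theta_app0.
rewrite !theta_appS; try exact: dp_der_comm.
by rewrite dp_subst_der IHe.
Qed.

Lemma dp_rename_theta (r : J -> J') e p :
  dp_rename r (theta_app (@dp_der m K J) e p) =
  theta_app (@dp_der m K J') e (dp_rename r p).
Proof. exact: dp_subst_theta. Qed.

Lemma dp_renameY (r : J -> J') j : dp_rename r (dY K j) = dY K (r j).
Proof. exact: dp_renameX. Qed.

Lemma dp_rename_comp (J2 : choiceType) (r : J -> J') (r' : J' -> J2) (p : dpoly K J) :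
  dp_rename r' (dp_rename r p) = dp_rename (r' \o r) p.
Proof.
apply: (@dp_morph_eq _ _ _ _ (dp_rename r' \o dp_rename r)
  (dp_rename (r' \o r))) => [a|v] /=.
  by rewrite !dp_renameC.
by rewrite !dp_renameX.
Qed.

Lemma dp_rename_ext (r r' : J -> J') (p : dpoly K J) :
  r =1 r' -> dp_rename r p = dp_rename r' p.
Proof.
move=> rr'; apply: dp_morph_eq => [a|v] /=; first by rewrite !dp_renameC.
by rewrite !dp_renameX rr'.
Qed.

Lemma dp_rename_id (p : dpoly K J) : dp_rename id p = p.
Proof.
apply: (@dp_morph_eq _ _ _ _ (dp_rename id) idfun) => [a|[j e]] /=.
  by rewrite dp_renameC.
by rewrite dp_renameX.
Qed.

Lemma wlt_subst (w : dvar m J -> nat) (w' : dvar m J' -> nat)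
    (x : J -> dpoly K J') n p :
  (forall v, v \in dvars p ->
    wlt w' (w v).+1 (theta_app (@dp_der m K J') v.2 (x v.1))) ->
  wlt w n.+1 p -> wlt w' n.+1 (dp_subst x p).
Proof.
move=> xw; apply: (@filtration_hom _ _ _ _ (fun k => wlt w' k.+1)) xw.
- by move=> i j a ij; apply: wltW.
- by move=> i; apply: wlt0.
- by move=> i a b; apply: wltD.
- exact: wlt1.
- by move=> i j a b ai bj; rewrite -addnS; apply: wltM.
- by move=> a; apply: wltC.
Qed.

Lemma vars_in_subst (Q : pred (dvar m J)) (Q' : pred (dvar m J'))
    (x : J -> dpoly K J') p :
  (forall v, Q v -> vars_in Q' (theta_app (@dp_der m K J') v.2 (x v.1))) ->
  vars_in Q p -> vars_in Q' (dp_subst x p).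
Proof.
move=> xQ pQ; apply: (@dp_ind_in _ _ _ (fun q => vars_in Q' (dp_subst x q))).
- by move=> a; rewrite dp_substC; apply: vars_inC.
- by move=> v /pQ/xQ; rewrite dp_substX.
- by move=> q r qQ rQ; rewrite rmorphD; apply: vars_inD.
- by move=> q r qQ rQ; rewrite rmorphM; apply: vars_inM.
Qed.

Lemma vars_in_rename (Q : pred (dvar m J)) (Q' : pred (dvar m J'))
    (r : J -> J') (p : dpoly K J) :
  (forall v, Q v -> Q' (r v.1, v.2)) -> vars_in Q p -> vars_in Q' (dp_rename r p).
Proof.
move=> rQ; apply: vars_in_subst => v vQ; rewrite theta_app_dY.
by apply: vars_inX; apply: rQ.
Qed.

(** On the ring generated by the variables, pairs of bounds for q and for its
derivative propagate through sums and, by the Leibniz rule, through products. *)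
Lemma wlt_der (w : dvar m J -> nat) (c : nat) i n (p : dpoly K J) :
  (forall v, (w (v.1, v.2 + theta_delta i)%R <= w v + c)%N) ->
  wlt w n p -> wlt w (n + c) (dp_der i p).
Proof.
move=> wc; case: n => [p0|n pn].
  have /eqP -> : p == 0 by rewrite -(grade_eq0 w) -size_poly_eq0 -leqn0; apply/wltP.
  by rewrite dp_der0; apply: wlt0.
pose L k (q : dpoly K J) := wlt w k.+1 q /\ wlt w (k + c).+1 (dp_der i q).
have idE : dp_hom (@dC m K J) (@dX m K J) p = p.
  apply: (@dp_morph_eq _ _ _ _ (dp_hom (@dC m K J) (@dX m K J)) idfun) => [a|v].
    exact: dp_homC.
  exact: dp_homX.
suff [] : L n (dp_hom (@dC m K J) (@dX m K J) p) by rewrite idE addSn.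
apply: (@filtration_hom _ _ _ _ L) pn.
- move=> j k q jk [q1 q2]; split; first exact: wltW q1.
  by apply: wltW q2; rewrite ltnS leq_add2r.
- by move=> k; split; rewrite ?dp_der0; apply: wlt0.
- move=> k q r [q1 q2] [r1 r2]; rewrite /L (dp_derD i q r).
  by split; apply: wltD.
- split; first exact: wlt1.
  rewrite -(rmorph1 (@dC m K J)) dp_derC df_der1 rmorph0; exact: wlt0.
- move=> j k q r [q1 q2] [r1 r2]; rewrite /L (dp_derM i q r); split.
    by rewrite -addnS; apply: wltM.
  apply: wltD; last by rewrite -addnA -addnS; apply: wltM.
  by rewrite addnAC -addnS; apply: wltM.
- move=> a; split; first exact: wltC.
  by rewrite dp_derC; apply: (@wltW _ _ _ _ 1) => //; apply: wltC.
- move=> v _; split; first exact: wltX.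
  by rewrite dp_derX; apply: wltW (@wltX _ _ _ w _); rewrite ltnS.
Qed.

End SubstFacts.

Section DeltaIdeals.
Variables (m : nat) (K : deltaField m) (J : choiceType).

Lemma delta_gen_ideal (G : dpoly K J -> Prop) : delta_ideal (delta_gen G).
Proof.
split; first split=> //.
- by move=> I [[]].
- move=> x y xG yG I II GI; case: (II) => -[_ _ ID _] _.
  by apply: ID; [apply: xG | apply: yG].
- move=> a x _ xG I II GI; case: (II) => -[_ _ _ IM] _.
  by apply: IM => //; apply: xG.
- by move=> i p pG I II GI; case: (II) => _; apply; apply: pG.
Qed.

Lemma delta_gen_mem (G : dpoly K J -> Prop) p : G p -> delta_gen G p.
Proof. by move=> Gp I _; apply. Qed.

Variables (J' : choiceType) (x : J -> dpoly K J').

Lemma delta_ideal_preim (I : dpoly K J' -> Prop) :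
  delta_ideal I -> delta_ideal (fun p => I (dp_subst x p)).
Proof.
move=> [[_ I0 ID IM] Id]; split; first split=> //.
- by rewrite rmorph0.
- by move=> p q pI qI; rewrite rmorphD; apply: ID.
- by move=> p q _ qI; rewrite rmorphM; apply: IM.
- by move=> i p pI; rewrite dp_subst_der; apply: Id.
Qed.

Lemma delta_gen_subst (G : dpoly K J -> Prop) (I : dpoly K J' -> Prop) p :
  delta_ideal I -> (forall q, G q -> I (dp_subst x q)) ->
  delta_gen G p -> I (dp_subst x p).
Proof. by move=> /delta_ideal_preim II GI pG; apply: (pG _ II). Qed.

(** The ideal generated by I after adjunction of lambda. This form makes it clear that
it is stable under derivations and that the coefficients of its members are in I. *)
Inductive lam_ext (I : dpoly K J -> Prop) : dpoly K (option J) -> Prop :=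
| lam_ext0 : lam_ext I 0
| lam_extD p q : lam_ext I p -> lam_ext I q -> lam_ext I (p + q)
| lam_extM g q : I g -> lam_ext I (dp_rename Some g * q).

Lemma lam_ext_mem (I : dpoly K J -> Prop) g : I g -> lam_ext I (dp_rename Some g).
Proof. by move=> gI; rewrite -[dp_rename _ _]mulr1; apply: lam_extM. Qed.

Lemma lam_ext_ideal (I : dpoly K J -> Prop) : delta_ideal I -> delta_ideal (lam_ext I).
Proof.
move=> [_ Id]; split; first split=> //.
- exact: lam_ext0.
- exact: lam_extD.
- move=> a p _; elim=> [|q r _ q1 _ r1|g q gI].
  + by rewrite mulr0; apply: lam_ext0.
  + by rewrite mulrDr; apply: lam_extD.
  + by rewrite mulrCA; apply: lam_extM.
move=> i p; elim=> [|q r _ q1 _ r1|g q gI].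
- by rewrite dp_der0; apply: lam_ext0.
- by rewrite (dp_derD i q r); apply: lam_extD.
- rewrite (dp_derM i (dp_rename Some g)) -dp_rename_der.
  by apply: lam_extD; apply: lam_extM => //; apply: Id.
Qed.

Lemma lam_ext_lcoef (I : dpoly K J -> Prop) nu p :
  delta_ideal I -> lam_ext I p -> I (lcoef nu p).
Proof.
move=> [[_ I0 ID IM] _]; elim=> [|q r _ q1 _ r1|g q gI].
- by rewrite lcoef0.
- by rewrite lcoefD; apply: ID.
- by rewrite lcoef_renameM mulrC; apply: IM.
Qed.

End DeltaIdeals.

(** * Symmetries of the ideal of a Chow form *)

Section ChowIdeal.
Variables (m n d : nat) (F : deltaField m) (I : dpoly F 'I_n -> Prop).
Notation U := (uvar n d).
Notation YU := (yuvar n d).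

Let G (f : dpoly F YU) :=
  (exists2 p, I p & f = dp_rename (inl : _ -> YU) p) \/
  (exists i, f = generic_hyperplane n F i).

Definition move_block (s : 'I_d.+1 -> 'I_d.+1) (u : U) : U := (s u.1, u.2).

Lemma chow_ideal_move s (g : dpoly F U) :
  chow_ideal I g -> chow_ideal I (dp_rename (move_block s) g).
Proof.
pose sY (y : YU) : YU :=
  match y with inl j => inl j | inr u => inr (move_block s u) end.
rewrite /chow_ideal -/G => gI.
have -> : dp_rename (inr : _ -> YU) (dp_rename (move_block s) g) =
    dp_rename sY (dp_rename (inr : _ -> YU) g).
  by rewrite !dp_rename_comp; apply: dp_rename_ext.
apply: (delta_gen_subst (delta_gen_ideal G)) gI => q qG; apply: delta_gen_mem.
rewrite -/(dp_rename sY q); case: qG => [[p pI ->]|[i ->]].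
  by left; exists p => //; rewrite dp_rename_comp; apply: dp_rename_ext.
right; exists (s i); rewrite /generic_hyperplane rmorphD rmorph_sum; congr (_ + _).
  by rewrite /= (dp_renameY F sY).
apply: eq_bigr => j _; rewrite rmorphM; congr (_ * _); exact: (dp_renameY F sY).
Qed.

Definition scale_yblock (i : 'I_d.+1) (y : YU) : dpoly F (option YU) :=
  match y with
  | inl _ => dY F (Some y)
  | inr u => if u.1 == i then dY F None * dY F (Some y) else dY F (Some y)
  end.

Lemma scale_hyperplane i k : dp_subst (scale_yblock i) (generic_hyperplane n F k) =
  dp_rename Some (generic_hyperplane n F k) * (if k == i then dY F None else 1).
Proof.
rewrite /generic_hyperplane rmorphD rmorph_sum [in RHS]rmorphD [in RHS]rmorph_sum.
rewrite [RHS]mulrDl; congr (_ + _).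
  rewrite [LHS](dp_substY (scale_yblock i)) /=.
  rewrite [X in _ = X * _](dp_renameY F (Some : YU -> option YU)).
  by case: eqP; rewrite ?mulr1 // mulrC.
rewrite [RHS]mulr_suml; apply: eq_bigr => j _; rewrite rmorphM [in RHS]rmorphM.
rewrite [X in X * _ = _](dp_substY (scale_yblock i)).
rewrite [X in _ * X = _](dp_substY (scale_yblock i)) /=.
rewrite [X in _ = X * _ * _](dp_renameY F (Some : YU -> option YU)).
rewrite [X in _ = _ * X * _](dp_renameY F (Some : YU -> option YU)).
case: eqP => _; last by rewrite mulr1.
exact: etrans (esym (mulrA _ _ _)) (mulrC _ _).
Qed.

Lemma scale_block_inr i (g : dpoly F U) :
  dp_subst (scale_yblock i) (dp_rename (inr : _ -> YU) g) =
  dp_rename (omap inr) (dp_subst (scale_block F i) g).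
Proof.
pose h : {rmorphism dpoly F U -> dpoly F (option YU)} :=
  dp_subst (scale_yblock i) \o dp_rename (inr : _ -> YU).
pose h' : {rmorphism dpoly F U -> dpoly F (option YU)} :=
  dp_rename (omap (inr : _ -> YU)) \o dp_subst (scale_block F i).
apply: (@dp_morph_eq _ _ _ _ h h') => [a|[u e]]; rewrite /h /h' /=.
  by rewrite dp_renameC !dp_substC dp_renameC.
rewrite dp_renameX !dp_substX /= dp_rename_theta; congr theta_app.
rewrite /scale_block; case: ifP => _; [rewrite [RHS]rmorphM; congr (_ * _)|];
  by apply: esym; exact: (dp_renameY F (omap (inr : _ -> YU))).
Qed.

(** In the larger ring L_i is sent to lambda L_i, the other generators are fixed: the
image of the ideal lies in its own extension by lambda. Coefficients are taken
there, with the y present, and commute with the inclusion of the u-variables. *)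
Lemma chow_ideal_lcoef i nu (g : dpoly F U) :
  chow_ideal I g -> chow_ideal I (lcoef nu (dp_subst (scale_block F i) g)).
Proof.
rewrite /chow_ideal -/G => gI; rewrite -lcoef_rename -scale_block_inr.
apply: (lam_ext_lcoef _ (delta_gen_ideal G)).
apply: (delta_gen_subst (lam_ext_ideal (delta_gen_ideal G))) gI => q [[p pI ->]|[k ->]].
  have -> : dp_subst (scale_yblock i) (dp_rename (inl : _ -> YU) p) =
      dp_rename Some (dp_rename (inl : _ -> YU) p).
    rewrite dp_rename_comp; pose h : {rmorphism dpoly F 'I_n -> dpoly F (option YU)} :=
      dp_subst (scale_yblock i) \o dp_rename (inl : _ -> YU).
    apply: (@dp_morph_eq _ _ _ _ h (dp_rename (Some \o (inl : _ -> YU)))) => [a|[j e]].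
      by rewrite /h /= !dp_renameC dp_substC.
    by rewrite /h /= !dp_renameX dp_substX /= theta_app_dY.
  by apply: lam_ext_mem; apply: delta_gen_mem; left; exists p.
rewrite scale_hyperplane; apply: lam_extM; apply: delta_gen_mem; right; by exists k.
Qed.

End ChowIdeal.

Section Irreducible.
Variables (m : nat) (K : deltaField m) (J : choiceType) (f : dpoly K J).
Hypothesis firr : irreducible f.

Lemma irreducible_neq0 : f != 0.
Proof. by case: firr => /eqP. Qed.

Lemma leader_exists (rk : rel (dvar m J)) : ranking rk -> exists v, leader rk v f.
Proof.
move=> [tot _ tr _ _].
have [s0|] := eqVneq (enum_fset (dvars f)) [::]; last first.
  by case/(total_max tot tr) => v vf vmax; exists v; split.
have [a fE] : exists a, f = dC J a.
  apply: dC_of_no_vars => v; apply/negP => vf.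
  have: v \in enum_fset (dvars f) by [].
  by rewrite s0.
have [_ fU _] := firr; case: fU; rewrite fE; apply: dC_invertible.
by apply: contraNneq irreducible_neq0 => a0; rewrite fE a0 rmorph0.
Qed.

End Irreducible.

Section Symmetry.
Variables (m n d : nat) (F : deltaField m) (I : dpoly F 'I_n -> Prop).
Notation U := (uvar n d).
Variables (rk : rel (dvar m U)) (hrk : ranking rk) (f : dpoly F U).
Hypothesis hf : is_chow_form rk I f.

Let firr : irreducible f. Proof. by case: hf. Qed.
Let f0 : f != 0. Proof. exact: irreducible_neq0. Qed.

Lemma chow_form_mem : chow_ideal I f.
Proof.
case: hf => _ ->; have [v vf] := leader_exists firr hrk.
by exists v => //; exists 0%N; rewrite expr0 mul1r; apply: delta_gen_mem.
Qed.

Lemma chow_ideal_low_divides (rk2 : rel (dvar m U)) v g :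
  ranking rk2 -> leader rk2 v f -> chow_ideal I g ->
  vars_in (fun u => rk2 u v) g -> divides f g.
Proof. by case: hf => _ gS hrk2 hv /gS; apply: sat_low_divides. Qed.

Section Involution.
Variable s : 'I_d.+1 -> 'I_d.+1.
Hypothesis sK : involutive s.

Let su (v : dvar m U) : dvar m U := (move_block s v.1, v.2).

Let suK : involutive su.
Proof. by case=> [[k j] e]; rewrite /su /move_block /= sK. Qed.

Let rks : rel (dvar m U) := relpre su rk.

Let rks_ranking : ranking rks.
Proof.
case: hrk => tot anti tr r1 r2; split.
- by move=> u v; apply: tot.
- by move=> u v /anti/(can_inj suK).
- by move=> v u w; apply: tr.
- by move=> u e e'; apply: r1.
- by move=> u w e e' e'' /r2; apply.
Qed.

(** Let v be the leader of f for rk, and v2 the one for the ranking transported by s,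
so that su v2 is the leader of s(f) for rk. Depending on which of v and su v2 is
higher, s(f) is low for rk or for the transported ranking. *)
Lemma chow_form_move : exists2 a, a != 0 & dp_rename (move_block s) f = dC U a * f.
Proof.
pose fs := dp_rename (move_block s) f.
have fsK : dp_rename (move_block s) fs = f.
  rewrite dp_rename_comp -[RHS]dp_rename_id; apply: dp_rename_ext => -[k j].
  by rewrite /= /move_block /= sK.
have fsI : chow_ideal I fs by apply: chow_ideal_move; apply: chow_form_mem.
have [v [vf fv]] := leader_exists firr hrk.
have [v2 [v2f fv2]] := leader_exists firr rks_ranking.
have dvd : divides f fs.
  have [tot _ tr _ _] := hrk.
  have [v2v|vv2] := orP (tot (su v2) v).
    apply: (@chow_ideal_low_divides rk v) => //.
    apply: (@vars_in_rename _ _ _ _ (mem (dvars f))) => // u /fv2 uv2.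
    exact: tr uv2 v2v.
  apply: (@chow_ideal_low_divides rks v2) => //.
  apply: (@vars_in_rename _ _ _ _ (mem (dvars f))) => // u /fv uv.
  by rewrite /rks /= suK; apply: tr uv vv2.
have fsdeg : wlt (fun=> 1%N) (tdeg f).+1 fs.
  apply: (@wlt_subst _ _ _ _ (fun=> 1%N)).
    by move=> u _; rewrite theta_app_dY; apply: (@wltX _ _ _ (fun=> 1%N)).
  by apply/(wlt_wdeg _ _ f0).
have [a aE] := tdeg_divides_const f0 dvd fsdeg.
exists a => //; apply: contraNneq f0 => a0.
by rewrite -fsK aE a0 rmorph0 mul0r rmorph0.
Qed.

End Involution.

End Symmetry.

(** * Homogeneity of the Chow form *)

Section Scaling.
Variables (m n d : nat) (F : deltaField m).
Notation U := (uvar n d).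
Notation D := (@dp_der m F (option U)).
Notation lam := (dY F (None : option U)).
Implicit Types (e : Theta m) (u : U).

Definition uord (v : dvar m (option U)) : nat :=
  if v.1 is Some _ then theta_ord v.2 else 0%N.

Definition udeg (v : dvar m (option U)) : nat :=
  if v.1 is Some _ then 1%N else 0%N.

Lemma wlt_uord_der i k (p : dpoly F (option U)) :
  wlt uord k p -> wlt uord k.+1 (dp_der i p).
Proof.
rewrite -addn1; apply: wlt_der => -[[u|] e] //=.
by rewrite /uord /= theta_ordD theta_ord_delta.
Qed.

Lemma wlt_udeg_der i k (p : dpoly F (option U)) :
  wlt udeg k p -> wlt udeg k (dp_der i p).
Proof. by move=> pk; rewrite -[k]addn0; apply: wlt_der pk => -[[u|] e]. Qed.

Lemma scale_udeg i u e : wlt udeg 2 (theta_app D e (scale_block F i u)).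
Proof.
elim/theta_ind: e => [|e k IHe]; last first.
  by rewrite theta_appS; [apply: wlt_udeg_der | exact: dp_der_comm].
rewrite theta_app0 /scale_block; case: ifP => _; last exact: (@wltX _ _ _ udeg).
by apply: (@wltM _ _ _ udeg 0 2); apply: (@wltX _ _ _ udeg).
Qed.

(** The part of theta(lambda u_ij) of highest order in the u, namely
lambda theta(u_ij); it is theta(u_ij) for the variables of the other blocks. *)
Definition scale_lead (i : 'I_d.+1) (v : dvar m U) : dpoly F (option U) :=
  lam ^+ (v.1.1 == i) * dX F (Some v.1, v.2).

(** Leibniz rule: each further derivation that hits lambda instead of y leaves a
term of lower order in y. *)
Lemma scale_leading i v :
  wlt uord (theta_ord v.2) (theta_app D v.2 (scale_block F i v.1) - scale_lead i v).
Proof.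
case: v => u e /=; rewrite /scale_block /scale_lead /=; case: (u.1 == i); last first.
  by rewrite expr0 mul1r theta_app_dY subrr; apply: wlt0.
rewrite expr1; elim/theta_ind: e => [|e k IHe].
  by rewrite theta_app0 theta_ord0 subrr; apply: wlt0.
rewrite theta_appS; last exact: dp_der_comm.
set a := theta_app _ _ _ in IHe *.
have -> : dX F (Some u, e + theta_delta k) =
    dp_der k (dX F (Some u, e) : dpoly F (option U)).
  by rewrite dp_derX.
set y := dX F (Some u, e) in IHe *; set l := lam in IHe *.
have -> : dp_der k a - l * dp_der k y = dp_der k (a - l * y) + dp_der k l * y.
  have aE : a = (a - l * y) + l * y by rewrite subrK.
  by rewrite {1}aE (dp_derD k (a - l * y)) (dp_derM k l y) addrA addrK.
rewrite theta_ordD theta_ord_delta addn1; apply: wltD; first exact: wlt_uord_der.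
rewrite -[(theta_ord e).+1]add0n; apply: wltM; last exact: (@wltX _ _ _ uord).
by rewrite /l /dY dp_derX; apply: (@wltX _ _ _ uord).
Qed.

Definition lower_der u e : pred (dvar m (option U)) := fun x =>
  if x.1 is Some u' then (u' == u) && [forall k, x.2 k <= e k]%N else true.

Lemma scale_vars i u e : vars_in (lower_der u e) (theta_app D e (scale_block F i u)).
Proof.
elim/theta_ind: e => [|e k IHe].
  have uP : lower_der u 0 (Some u, 0) by rewrite /lower_der /= eqxx; apply/forallP.
  rewrite theta_app0 /scale_block; case: ifP => _; last exact: vars_inX.
  by apply: vars_inM; apply: vars_inX.
rewrite theta_appS; last exact: dp_der_comm.
apply: vars_in_der IHe => -[[u'|] e'] //; rewrite /lower_der /=.
case/andP=> -> /forallP/= le_e; split; apply/forallP => l; rewrite !thetaDE.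
  exact: leq_trans (le_e l) (leq_addr _ _).
by rewrite leq_add2r.
Qed.

Section Leader.
Variables (rk : rel (dvar m U)) (hrk : ranking rk) (f : dpoly F U) (v : dvar m U).
Hypothesis hv : leader rk v f.

Lemma lower_der_rk u e u' e' : rk (u, e) v -> lower_der u e (Some u', e') ->
  rk (u', e') v.
Proof.
move=> uv /andP[/eqP-> /forallP/= le_e]; apply: (rk_trans hrk) uv.
have -> : (u, e) = shift (u, e') [ffun k => e k - e' k]%N.
  by congr pair; apply/ffunP => k; rewrite thetaDE ffunE subnKC.
exact: rk_shiftr.
Qed.

Lemma lcoef_scale_vars i nu :
  vars_in (fun x => rk x v) (lcoef nu (dp_subst (scale_block F i) f)).
Proof.
pose Q (x : dvar m (option U)) := if x.1 is Some u then rk (u, x.2) v else true.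
have: vars_in Q (dp_subst (scale_block F i) f).
  apply: (@vars_in_subst _ _ _ _ (mem (dvars f))) => // -[u e]; case: hv => _ fv /fv uv.
  by apply: vars_inW (@scale_vars i u e) => -[[u'|] e'] //; apply: lower_der_rk.
move=> /wlt_dvars pQ; apply: (@vars_inW _ _ _ (fun x => rk (x.1, x.2) v)).
  by case.
by apply/wlt_dvars; exact: (wlt_lcoef (nu := nu) pQ).
Qed.

End Leader.

Lemma lcoef_scale_tdeg i nu (f : dpoly F U) : f != 0 ->
  wlt (fun=> 1%N) (tdeg f).+1 (lcoef nu (dp_subst (scale_block F i) f)).
Proof.
move=> f0; apply: (@wlt_lcoef _ _ _ udeg).
apply: (@wlt_subst _ _ _ _ (fun=> 1%N)); first by move=> u _; apply: scale_udeg.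
by apply/(wlt_wdeg _ _ f0).
Qed.

Definition ordU (v : dvar m U) : nat := theta_ord v.2.
Definition block_deg (i : 'I_d.+1) (v : dvar m U) : nat := v.1.1 == i.

Lemma scale_lead_uord i v : wlt uord (ordU v).+1 (scale_lead i v).
Proof.
rewrite -[(ordU v).+1]add0n; apply: wltM; last exact: (@wltX _ _ _ uord).
by case: (v.1.1 == i); [apply: (@wltX _ _ _ uord) | apply: wlt1].
Qed.

(** A product of polynomials is congruent to the product of their leading parts, up to
lower order. *)
Lemma scale_mon i (mu : {cmonom (dvar m U)}) :
  wlt uord (wt ordU mu) (mon_val (fun v => theta_app D v.2 (scale_block F i v.1)) mu
                         - mon_val (scale_lead i) mu).
Proof.
pose R k (a b : dpoly F (option U)) := wlt uord k (a - b) /\ wlt uord k.+1 b.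
have R1 : R 0%N 1 1 by rewrite /R subrr; split; [apply: wlt0 | apply: wlt1].
have RM k a b k' a' b' : R k a b -> R k' a' b' -> R (k + k')%N (a * a') (b * b').
  move=> [ab b1] [ab' b1']; split; last by rewrite -addnS; apply: wltM.
  have -> : a * a' - b * b' = a' * (a - b) + b * (a' - b').
    by rewrite !mulrBr (mulrC a' a) (mulrC a' b) addrA subrK.
  apply: wltD; last exact: wltM.
  rewrite addnC; apply: wltM => //.
  by rewrite -(subrK b' a'); apply: wltD => //; apply: wltW ab'.
suff [] : R (wt ordU mu) (mon_val (fun v => theta_app D v.2 (scale_block F i v.1)) mu)
    (mon_val (scale_lead i) mu) by [].
rewrite /wt /mon_val; apply: (big_rec3 R) => // v k a b _ Rab.
apply: (RM) Rab; elim: (mu v) => [|j IHj]; first by rewrite mul0n !expr0.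
rewrite mulSn !exprS; apply: RM IHj; split; last exact: scale_lead_uord.
exact: scale_leading.
Qed.

Lemma scale_lead_mon i (mu : {cmonom (dvar m U)}) :
  mon_val (scale_lead i) mu =
  dp_rename Some (dp_mono 1 mu : dpoly F U) * lam ^+ wt (block_deg i) mu.
Proof.
rewrite [X in _ = X * _]dp_hom_mono rmorph1 mul1r mulrC /wt expr_sum -big_split.
apply: eq_bigr => v _; rewrite /= theta_app_dY /scale_lead exprMn -exprM.
by rewrite mulnC.
Qed.

(** Monomials of lower order in the u cannot produce mu0, nor can any other monomial
of the same order, whose leading part is a power of lambda times itself. *)
Lemma lcoef_scale_top i nu (f : dpoly F U) mu0 : mu0 \in msupp f ->
  (forall mu, mu \in msupp f -> (wt ordU mu <= wt ordU mu0)%N) ->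
  (lcoef nu (dp_subst (scale_block F i) f))@_mu0 =
  f@_mu0 *+ (expcmn (ucm 0) (wt (block_deg i) mu0) == nu).
Proof.
move=> mu0f mu0max; set p := dp_subst _ _.
pose X v := theta_app D v.2 (scale_block F i v.1).
have pE : p = \sum_(mu <- msupp f) dC (option U) f@_mu * mon_val X mu by [].
(* q is the sum of the leading parts; it differs from p in lower order only. *)
pose q := \sum_(mu <- msupp f) dC (option U) f@_mu * mon_val (scale_lead i) mu.
have pq : wlt uord (wt ordU mu0) (p - q).
  rewrite pE /q -sumrB; apply: wlt_sum => mu muf; rewrite -mulrBr.
  apply: wltW (mu0max mu muf) _; rewrite -[wt _ mu]add0n; apply: wltM; first exact: wltC.
  exact: scale_mon.
have low0 : (lcoef nu (p - q))@_mu0 = 0.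
  apply: mcoeff_outdom; apply/negP => /(wlt_lcoef pq).
  by rewrite -[X in (X < _)%N]/(wt ordU mu0) ltnn.
have -> : (lcoef nu p)@_mu0 = (lcoef nu q)@_mu0.
  have drop (a b c : dpoly F U) : a = b + c -> b@_mu0 = 0 -> a@_mu0 = c@_mu0.
    by move=> -> b0; rewrite mcoeffD b0 add0r.
  apply: drop low0; clearbody p q.
  by have := lcoefD nu (p - q) q; rewrite subrK.
rewrite /q lcoef_sum raddf_sum /= (big_fsetD1 mu0) //= big1_fset ?addr0.
  rewrite lcoef_dCM mcoeff_dCM scale_lead_mon lcoef_renameM lcoef_lambda_exp.
  case: eqP => _; last by rewrite mulr0 mcoeff0 mulr0.
  by rewrite mulr1 mcoeff_mono eqxx mulr1.
move=> mu /fsetD1P[mumu0 muf] _.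
rewrite lcoef_dCM mcoeff_dCM scale_lead_mon lcoef_renameM lcoef_lambda_exp.
case: eqP => _; last by rewrite mulr0 mcoeff0 mulr0.
by rewrite mulr1 mcoeff_mono (negPf mumu0) mulr0n mulr0.
Qed.

End Scaling.

Section Homogeneity.
Variables (m n d : nat) (F : deltaField m) (I : dpoly F 'I_n -> Prop).
Notation U := (uvar n d).
Variables (rk : rel (dvar m U)) (hrk : ranking rk) (f : dpoly F U).
Hypothesis hf : is_chow_form rk I f.

Let firr : irreducible f. Proof. by case: hf. Qed.
Let f0 : f != 0. Proof. exact: irreducible_neq0. Qed.

(** The degree r is that of a monomial mu0 of f of maximal order; comparing coefficients
of mu0 determines the constants c_nu. *)
Lemma chow_form_homogeneous_block i : exists r, delta_homogeneous i r f.
Proof.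
have [v hv] := leader_exists firr hrk.
have [s0|] := eqVneq (enum_fset (msupp f)) [::].
  case/eqP: f0; apply/malgP => mu; rewrite mcoeff0; apply: mcoeff_outdom.
  by apply/negP => muf; have: mu \in enum_fset (msupp f) by []; rewrite s0.
pose le_ord (mu nu : {cmonom (dvar m U)}) :=
  (wt (@ordU m n d) mu <= wt (@ordU m n d) nu)%N.
have gtot : total le_ord by move=> mu nu; apply: leq_total.
have gtr : transitive le_ord by move=> mu nu rho; apply: leq_trans.
case/(total_max gtot gtr) => mu0 mu0f mu0max.
pose r := wt (block_deg i) mu0; exists r; apply: lcoef_inj => nu.
have gdvd : divides f (lcoef nu (dp_subst (scale_block F i) f)).
  apply: (chow_ideal_low_divides hf hrk hv); last exact: lcoef_scale_vars.
  by apply: chow_ideal_lcoef; apply: (chow_form_mem hrk hf).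
have [a aE] := tdeg_divides_const f0 gdvd (@lcoef_scale_tdeg _ _ _ _ i nu f f0).
have := @lcoef_scale_top _ _ _ _ i nu f mu0 mu0f mu0max.
rewrite aE mcoeff_dCM mulrC -mulr_natr.
have fmu0 : f@_mu0 != 0 by rewrite (mcoeff_neq0 f).
move/(mulfI fmu0) => ->.
rewrite [X in _ = lcoef _ X]mulrC lcoef_renameM lcoef_lambda_exp.
by rewrite rmorph_nat mulrC.
Qed.

Lemma scale_block_move (s : 'I_d.+1 -> 'I_d.+1) i (g : dpoly F U) : injective s ->
  dp_subst (scale_block F (s i)) (dp_rename (move_block s) g) =
  dp_rename (omap (move_block s)) (dp_subst (scale_block F i) g).
Proof.
move=> sI; pose h : {rmorphism dpoly F U -> dpoly F (option U)} :=
  dp_subst (scale_block F (s i)) \o dp_rename (@move_block n d s).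
pose h' : {rmorphism dpoly F U -> dpoly F (option U)} :=
  dp_rename (omap (@move_block n d s)) \o dp_subst (scale_block F i).
apply: (@dp_morph_eq _ _ _ _ h h') => [a|[u e]]; rewrite /h /h' /=.
  by rewrite dp_renameC !dp_substC dp_renameC.
rewrite dp_renameX !dp_substX /= dp_rename_theta; congr theta_app.
rewrite /scale_block /= (inj_eq sI).
pose mv := omap (@move_block n d s).
have mvY y : dp_rename mv (dY F y) = dY F (mv y) by exact: dp_renameY.
case: (u.1 == i); last exact: esym (mvY (Some u)).
exact: esym (etrans (rmorphM (dp_rename mv) _ _)
                    (f_equal2 *%R (mvY None) (mvY (Some u)))).
Qed.

Theorem chow_form_homogeneous : exists r, forall i, delta_homogeneous i r f.
Proof.
have [r hom0] := chow_form_homogeneous_block ord0; exists r => i.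
pose s : 'I_d.+1 -> 'I_d.+1 := tperm ord0 i.
have sK : involutive s by exact: tpermK.
have [a a0 aE] := chow_form_move hrk hf sK.
have aC0 : dC (option U) a != 0 by rewrite fmorph_eq0.
apply: (dp_mulfI aC0).
have := scale_block_move ord0 f (can_inj sK).
rewrite aE [s ord0]tpermL (rmorphM (dp_subst _)) /= dp_substC hom0 => ->.
pose mv := omap (@move_block n d s).
have mvL : dp_rename mv (dY F None ^+ r) = dY F None ^+ r.
  by rewrite rmorphXn; congr (_ ^+ _); exact: (dp_renameY F mv None).
have mvf : dp_rename mv (dp_rename Some f) = dC (option U) a * dp_rename Some f.
  rewrite dp_rename_comp (@dp_rename_ext _ _ _ _ _ (Some \o @move_block n d s)) //.
  by rewrite -dp_rename_comp aE rmorphM /= dp_renameC.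
rewrite (rmorphM (dp_rename _)) /= mvL mvf; exact: mulrCA.
Qed.

End Homogeneity.

Theorem theorem5p3 (m n d s : nat) (hm : (2 <= m)%N)
    (F E : deltaField m) (iota : {rmorphism F -> E})
    (hE : universal_ext iota)
    (V : 'rV[E]_n -> Prop) (hV : irreducible_variety iota V)
    (hw : is_kolchin_poly iota V
            (d.+1%:R *: bin_poly ('X + m%:R%:P) m
             - bin_poly ('X + (m%:R - s%:R)%:P) m))
    (rk : rel (dvar m (uvar n d))) (hrk : ranking rk)
    (f : dpoly F (uvar n d))
    (hf : is_chow_form rk (vanishing_ideal iota V) f) :
  exists r : nat, forall i : 'I_d.+1, delta_homogeneous i r f.
Proof. exact: (chow_form_homogeneous hrk hf). Qed.
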